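(* The largest possible number of strongly inessential generators in an e-maximal basis of an ideal $I\in\mathcal F[3]$ is $\alpha(I)-2$.
   Context: $K$ is an algebraically closed field, $S=K[X,Y,Z]$, $\mathfrak M=(X,Y,Z)$. A standard basis of a homogeneous ideal $I$ is an ordered set of forms generating $I$ such that its elements of degree $d$ define a $K$-basis of $I_d/(I_{d-1}S_1)$ for every $d$; $\nu(I)$ is its number of elements and $\alpha(I)$ the smallest degree of its elements. $\mathcal F[3]$ is the set of homogeneous perfect height $2$ ideals $I$ of $S$ (height $2$ and projective dimension of $S/I$ equal to $2$) with $\nu(I)=\alpha(I)+1$. Given a standard basis $\mathcal B$ of $I$, $f\in\mathcal B$ is inessential with respect to $\mathcal B$ if there is $t\in\mathbb N$ with $f\,\mathfrak M^t\subseteq(\mathcal B\setminus\{f\})S$; otherwise it is essential. A form $f\in I_d$ is strongly inessential if $f\notin I_{d-1}S$ and $f$ is inessential with respect to every standard basis of $I$ containing it. A standard basis is e-maximal if for every $d$ it has exactly $\nu_e(d)$ essential elements of degree $d$, where $\nu_e(d)$ is the greatest number of essential elements of degree $d$ appearing in a standard basis of $I$.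
   Formalization: For α(I)=1 (e.g. I=(X,Y)), where α(I)-2=-1 cannot be a number of generators, the largest number is stated to be 0; for α(I)≥2 it is α(I)-2, read as an upper bound for all I in F[3] that is attained for every value of α. *)

(* Defs.v *)
From HB Require Import structures.
From mathcomp Require Import all_boot all_algebra.
From mathcomp Require Import boolp classical_sets.
From mathcomp Require Import mpoly.

Set Implicit Arguments.
Unset Strict Implicit.
Unset Printing Implicit Defensive.

Import GRing.Theory.

Local Open Scope classical_set_scope.
Local Open Scope ring_scope.

(* The ideals of ring_quotient.v are proper and have decidable membership;
   here an ideal is any subset, possibly the whole ring. *)
Definition is_ideal (R : comNzRingType) (I : set R) : Prop :=
  [/\ I 0, forall u v, I u -> I v -> I (u + v) & forall a u, I u -> I (a * u)].

Definition ideal_gen (R : comNzRingType) (G : set R) : set R :=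
  smallest (@is_ideal R) G.

Definition ideal_pow (R : comNzRingType) (J : set R) (t : nat) : set R :=
  ideal_gen [set p | exists g : 'I_t -> R,
                       (forall k, J (g k)) /\ p = \prod_(k < t) g k].

Definition is_prime (R : comNzRingType) (P : set R) : Prop :=
  [/\ is_ideal P, ~ P 1 & forall u v, P (u * v) -> P u \/ P v].

(* Q 0 < ... < Q n = P; the values Q i for i > n are irrelevant. *)
Definition has_prime_chain (R : comNzRingType) (P : set R) (n : nat) : Prop :=
  exists Q : nat -> set R,
    [/\ forall i, (i <= n)%N -> is_prime (Q i),
        forall i, (i < n)%N -> Q i `<` Q i.+1 & Q n = P].

(* The minimum, over the primes P containing I, of the supremum of the lengths
   of the chains of primes ending at P; it does not exist for the unit ideal. *)
Definition has_height (R : comNzRingType) (I : set R) (h : nat) : Prop :=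
  (forall P, is_prime P -> I `<=` P -> has_prime_chain P h) /\
  (exists P, [/\ is_prime P, I `<=` P & ~ has_prime_chain P h.+1]).

Definition projective (R : nzRingType) (P : lmodType R) : Prop :=
  forall (M N : lmodType R) (g : {linear M -> N}) (h : {linear P -> N}),
    (forall y, exists x, g x = y) ->
    exists k : {linear P -> M}, forall x, g (k x) = h x.

(* M has a projective resolution
   0 -> P n -> ... -> P 1 -> P 0 -> M -> 0. *)
Definition projdim_le (R : nzRingType) (M : lmodType R) (n : nat) : Prop :=
  exists (P : nat -> lmodType R) (d : forall i, {linear P i.+1 -> P i})
         (e : {linear P 0%N -> M}),
    [/\ forall i, projective (P i),
        forall i, (n < i)%N -> forall x : P i, x = 0,
        forall y, exists x, e x = y,
        forall x, e x = 0 <-> exists y, d 0%N y = x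
      & forall i x, d i x = 0 <-> exists y, d i.+1 y = x].

Definition projdim (R : nzRingType) (M : lmodType R) (n : nat) : Prop :=
  projdim_le M n /\ forall m, projdim_le M m -> (n <= m)%N.

(* M is a model of the R-module R / I. *)
Definition is_quotient (R : comNzRingType) (I : set R) (M : lmodType R) : Prop :=
  exists pi : {linear R^o -> M},
    (forall y, exists x, pi x = y) /\ forall f, pi f = 0 <-> I f.

Notation poly3 K := {mpoly K[3]}.

(* The zero polynomial is homogeneous of every degree. *)
Definition form (K : fieldType) (f : poly3 K) : Prop :=
  exists d, f \is d.-homog.

Definition homogeneous_ideal (K : fieldType) (I : set (poly3 K)) : Prop :=
  is_ideal I /\ I = ideal_gen (I `&` @form K).

(* The homogeneous component I_d. *)
Definition component (K : fieldType) (I : set (poly3 K)) (d : nat) :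
    set (poly3 K) :=
  [set f | I f /\ f \is d.-homog].

(* I_{d-1} S_1 (zero for d = 0), i.e. the finite sums of products of an element
   of I_{d-1} by a linear form; this set is closed under scalars. *)
Definition lower_part (K : fieldType) (I : set (poly3 K)) (d : nat) :
    set (poly3 K) :=
  [set f | if d is e.+1 then
      exists (n : nat) (g l : 'I_n -> poly3 K),
        [/\ forall k, component I e (g k), forall k, l k \is 1.-homog
          & f = \sum_(k < n) g k * l k]
    else f = 0].

Definition in_degree (K : fieldType) (B : seq (poly3 K)) (d : nat) :
    seq (poly3 K) :=
  [seq f <- B | f \is d.-homog].

(* The classes of the entries of s form a K-basis of I_d / (I_{d-1} S_1). *)
Definition basis_mod_lower (K : fieldType) (I : set (poly3 K)) (d : nat)
    (s : seq (poly3 K)) : Prop :=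
  [/\ forall f, f \in s -> component I d f,
      forall f, component I d f -> exists c : 'I_(size s) -> K,
        lower_part I d (f - \sum_(i < size s) c i *: s`_i)
    & forall c : 'I_(size s) -> K,
        lower_part I d (\sum_(i < size s) c i *: s`_i) -> forall i, c i = 0].

(* Since S is Noetherian a standard basis is finite, so sequences suffice. *)
Definition standard_basis (K : fieldType) (I : set (poly3 K))
    (B : seq (poly3 K)) : Prop :=
  [/\ uniq B, forall f, f \in B -> form f, ideal_gen [set` B] = I
    & forall d, basis_mod_lower I d (in_degree B d)].

Definition is_nu (K : fieldType) (I : set (poly3 K)) (n : nat) : Prop :=
  exists B, standard_basis I B /\ size B = n.

Definition is_alpha (K : fieldType) (I : set (poly3 K)) (m : nat) : Prop :=
  exists B, [/\ standard_basis I B, exists2 f, f \in B & f \is m.-homog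
              & forall f d, f \in B -> f \is d.-homog -> (m <= d)%N].

Definition perfect_height2 (K : fieldType) (I : set (poly3 K)) : Prop :=
  has_height I 2 /\
  exists M : lmodType (poly3 K), is_quotient I M /\ projdim M 2.

Definition in_F3 (K : fieldType) (I : set (poly3 K)) : Prop :=
  [/\ homogeneous_ideal I, perfect_height2 I
    & exists a, is_alpha I a /\ is_nu I a.+1].

Definition irrelevant_ideal {K : fieldType} : set (poly3 K) :=
  ideal_gen [set p | exists i : 'I_3, p = 'X_i].

Definition inessential (K : fieldType) (B : seq (poly3 K)) (f : poly3 K) :
    Prop :=
  exists t : nat, forall m, ideal_pow irrelevant_ideal t m ->
    ideal_gen ([set` B] `\ f) (f * m).

Definition essential (K : fieldType) (B : seq (poly3 K)) (f : poly3 K) : Prop :=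
  ~ inessential B f.

(* I_{d-1} S is the ideal generated by I_{d-1}, with I_{-1} = 0. *)
Definition strongly_inessential (K : fieldType) (I : set (poly3 K))
    (f : poly3 K) : Prop :=
  exists d, [/\ component I d f,
                ~ ideal_gen (if d is e.+1 then component I e else [set 0]) f
              & forall B, standard_basis I B -> f \in B -> inessential B f].

Definition num_essential (K : fieldType) (B : seq (poly3 K)) (d : nat) : nat :=
  count (fun f => `[< essential B f >]) (in_degree B d).

Definition is_nu_e (K : fieldType) (I : set (poly3 K)) (d n : nat) : Prop :=
  (exists2 B, standard_basis I B & num_essential B d = n) /\
  (forall B, standard_basis I B -> (num_essential B d <= n)%N).

Definition e_maximal (K : fieldType) (I : set (poly3 K)) (B : seq (poly3 K)) :
    Prop :=
  standard_basis I B /\ forall d, is_nu_e I d (num_essential B d).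

Definition num_strongly_inessential (K : fieldType) (I : set (poly3 K))
    (B : seq (poly3 K)) : nat :=
  count (fun f => `[< strongly_inessential I f >]) B.

(* Main.v *)
Require Import Defs.
From HB Require Import structures.
From mathcomp Require Import all_boot all_algebra.
From mathcomp Require Import boolp classical_sets.
From mathcomp Require Import mpoly.
From mathcomp Require Import ring.

(** The upper bound comes from the following: if a standard basis [B] has a
    strongly inessential member, then it has at least three members that are not.
    As [B] has [a + 1] members, this leaves at most [a - 2].

    Let [T] be the set of strongly inessential members and [C] the rest.  A member
    [f] is inessential when its coefficients in the relations of the basis have no
    common zero in the projective plane.  Changing the basis alters these
    coefficients by multiples of those of the members of at least the degree of
    [f].  So, at a point [v], a linear dependency between the coefficients of the
    members of [T] could be concentrated, by a change of basis, in one member,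
    which would then not be inessential for the new basis
    ([strongly_inessential_independent]).  Therefore some square matrix of
    coefficients of [T] is invertible at [v], and its determinant multiplies [T]
    into the ideal [(C)] ([local_generation]).  By the Nullstellensatz
    ([projective_nullstellensatz]) some power of each variable multiplies [T] into
    [(C)].  But an ideal of [K[X, Y, Z]] with at most two generators is saturated
    ([saturated_two_generated]): its two generators have a principal module of
    relations, by unique factorization, so the Koszul complex of the variables
    leaves no room for a socle.  If [C] had at most two members, [(C)] would
    contain [T], against the minimality of [B].

    The bound is attained by the maximal minors of the [a + 1] by [a] matrix whose
    rows are [(- Y ^ 2, - Z ^ 3, 0, ...)], then [(X, - Y ^ 2, - Z ^ 3, 0, ...)] and
    its shifts, down to [(0, ..., X, - Y ^ 2)] and [(0, ..., 0, X)].  The minors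
    [f_ 0, ..., f_ a] have the distinct degrees [a, ..., 2 a], so every standard
    basis is triangular in them.  Three consecutive syzygies show that [X],
    [Y ^ 2] and [Z ^ 3] multiply [f_ i] into the ideal of the other members when
    [0 < i <= a - 2], whatever the basis ([ex_inessential]), while the entries of
    the rows [0], [a - 1] and [a] have common zeros ([ex_essential]).  The matrix
    gives a free resolution of length two ([minor_syzygies], [ex_resolution]),
    which cannot be shortened because [f_ 0 = X ^ a] and [f_ a], a power of [Y]
    modulo [X], form a regular sequence ([ex_no_short_resolution]); these two
    forms also bound the height below, and it is two because [(X, Y)] contains the
    ideal ([ex_height]). *)

Set Implicit Arguments.
Unset Strict Implicit.
Unset Printing Implicit Defensive.

Import GRing.Theory.

Local Open Scope classical_set_scope.
Local Open Scope ring_scope.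

(** * Ideals and their generators *)

Section Ideals.

Variable R : comNzRingType.
Implicit Types (I G : set R) (s : seq R).

Lemma idealD I u v : is_ideal I -> I u -> I v -> I (u + v).
Proof. by case=> _ + _; apply. Qed.

Lemma idealMl I a u : is_ideal I -> I u -> I (a * u).
Proof. by case=> _ _; apply. Qed.

Lemma idealMr I a u : is_ideal I -> I u -> I (u * a).
Proof. by rewrite mulrC; apply: idealMl. Qed.

Lemma idealN I u : is_ideal I -> I u -> I (- u).
Proof. by rewrite -mulN1r; apply: idealMl. Qed.

Lemma idealB I u v : is_ideal I -> I u -> I v -> I (u - v).
Proof. by move=> idI Iu Iv; apply: idealD => //; apply: idealN. Qed.

Lemma ideal_sum I (T : Type) (r : seq T) (P : pred T) (F : T -> R) :
  is_ideal I -> (forall i, P i -> I (F i)) -> I (\sum_(i <- r | P i) F i).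
Proof.
move=> idI IF; apply: big_ind => //; first by case: idI.
by move=> u v; apply: idealD.
Qed.

Lemma ideal_sum_seq I (T : eqType) (r : seq T) (F : T -> R) :
  is_ideal I -> (forall i, i \in r -> I (F i)) -> I (\sum_(i <- r) F i).
Proof. by move=> idI IF; rewrite big_seq; apply: ideal_sum. Qed.

Lemma is_ideal_gen G : is_ideal (ideal_gen G).
Proof.
split=> [A [[] //]|u v Gu Gv A AP|a u Gu A AP].
- by apply: (idealD AP.1); [apply: Gu | apply: Gv].
- by apply: (idealMl _ AP.1); apply: Gu.
Qed.

Lemma ideal_gen_inc G : G `<=` ideal_gen G.
Proof. exact: sub_gen_smallest. Qed.

Lemma ideal_gen_min G I : is_ideal I -> G `<=` I -> ideal_gen G `<=` I.
Proof. by move=> idI GI; apply: smallest_sub. Qed.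

Lemma ideal_gen_mono G1 G2 : G1 `<=` G2 -> ideal_gen G1 `<=` ideal_gen G2.
Proof.
move=> G12; apply: ideal_gen_min; first exact: is_ideal_gen.
by move=> x /G12; apply: ideal_gen_inc.
Qed.

Lemma is_ideal_add I u : is_ideal I ->
  is_ideal [set y | exists p a, I p /\ y = p + a * u].
Proof.
move=> idI; split=> /=.
- by exists 0, 0; rewrite mul0r addr0; split=> //; case: idI.
- move=> y z [p [a [Ip ->]]] [q [b [Iq ->]]]; exists (p + q), (a + b).
  by rewrite mulrDl addrACA; split=> //; apply: idealD.
- move=> c y [p [a [Ip ->]]]; exists (c * p), (c * a).
  by rewrite mulrDr mulrA; split=> //; apply: idealMl.
Qed.

(** Without repetitions the coefficients can be indexed by the generators
    themselves, which makes it easy to pass to a sublist. *)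
Lemma ideal_gen_seqP s x : uniq s ->
  ideal_gen [set` s] x <-> exists r : R -> R, x = \sum_(g <- s) r g * g.
Proof.
move=> us; split=> [|[r ->]]; last first.
  apply: ideal_sum_seq => [|g gs]; first exact: is_ideal_gen.
  by apply: (idealMl _ (is_ideal_gen _)); apply: ideal_gen_inc.
suff: ideal_gen [set` s] `<=` [set x | exists r, x = \sum_(g <- s) r g * g].
  exact.
apply: ideal_gen_min.
  split=> /=.
  - by exists (fun=> 0); rewrite big1 // => g _; rewrite mul0r.
  - move=> u v [r ->] [t ->]; exists (fun g => r g + t g).
    by rewrite -big_split; apply: eq_bigr => g _; rewrite mulrDl.
  - move=> a u [r ->]; exists (fun g => a * r g).
    by rewrite mulr_sumr; apply: eq_bigr => g _; rewrite mulrA.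
move=> g /= gs; exists (fun h => (h == g)%:R).
rewrite (bigD1_seq g) //= eqxx mul1r big1 ?addr0 // => h /negbTE ->.
by rewrite mul0r.
Qed.

Lemma set_seqD1 s f : [set` s] `\ f = [set` [seq g <- s | g != f]].
Proof.
apply/seteqP; split=> g /=; rewrite mem_filter.
  by case=> -> /eqP ->.
by case/andP=> /eqP.
Qed.

End Ideals.

Lemma is_prime_preim (A B : comNzRingType) (phi : {rmorphism A -> B})
    (P : set B) : is_prime P -> is_prime [set x | P (phi x)].
Proof.
case=> [[P0 PD PM] P1 PP]; split=> [|/=|u v /=].
- split=> [/=|u v /=|a u /=]; first by rewrite rmorph0.
    by rewrite rmorphD; apply: PD.
  by rewrite rmorphM; apply: PM.
- by rewrite rmorph1.
- by rewrite rmorphM; apply: PP.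
Qed.

Lemma prime_exp (A : comNzRingType) (P : set A) x k :
  is_prime P -> P (x ^+ k) -> P x.
Proof.
case=> _ P1 PP; elim: k => [|k IH]; first by rewrite expr0.
by rewrite exprS => /PP[].
Qed.

Lemma exists_minimal (T : Type) (A : T -> Prop) (sz : T -> nat) :
  (exists x, A x) -> exists2 x, A x & forall y, A y -> (sz x <= sz y)%N.
Proof.
case=> x0 Ax0.
have exP: exists n, `[< exists2 x, A x & sz x = n >].
  by exists (sz x0); apply/asboolP; exists x0.
case: (ex_minnP exP) => n /asboolP[x Ax <-] minn.
by exists x => // y Ay; apply: minn; apply/asboolP; exists y.
Qed.

(** * Contraction of primes from one more variable *)

Section PolyContraction.

Variable R : idomainType.
Implicit Types (P J : set {poly R}) (f g u v : {poly R}).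

Let tr f := f - lead_coef f *: 'X^((size f).-1).

Let size_tr f : f != 0 -> (size (tr f) < size f)%N.
Proof.
move=> nzf; rewrite /tr.
have sf: (0 < size f)%N by rewrite size_poly_gt0.
rewrite -[X in (_ < X)%N](prednK sf) ltnS; apply/leq_sizeP => j jge.
rewrite coefB coefZ coefXn; case: eqP => [->|nj].
  by rewrite mulr1 lead_coefE subrr.
rewrite mulr0 subr0 nth_default //.
by rewrite -(prednK sf) ltn_neqAle jge andbT; apply/eqP=> e; apply: nj.
Qed.

(** A member of least degree with a coefficient outside the contraction of [P];
    over the field of fractions of the constants modulo [P] it generates [P]. *)
Lemma prime_poly_generator P :
    is_prime P -> (exists g, P g /\ exists i, ~ P (g`_i)%:P) ->
  exists g, [/\ P g, ~ P (lead_coef g)%:P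
    & forall r, P r -> (size r < size g)%N -> forall i, P (r`_i)%:P].
Proof.
move=> [idP _ _] exg.
have [g [Pg [i0 gi0]] ming] :=
  @exists_minimal _ (fun g => P g /\ exists i, ~ P (g`_i)%:P) (fun g => size g) exg.
have nzg : g != 0.
  by apply/eqP => g0; apply: gi0; rewrite g0 coef0; case: idP.
exists g; split=> // [Pl|r Pr sr i].
  have: (size g <= size (tr g))%N.
    apply: ming; split.
      by apply: idealB => //; rewrite -mul_polyC; apply: idealMr.
    exists i0; rewrite coefB coefZ coefXn; case: eqP => [e|_].
      by case: gi0; rewrite e.
    by rewrite mulr0 subr0.
  by rewrite leqNgt size_tr.
apply: contrapT => nPi; move: sr.
by rewrite ltnNge ming //; split=> //; exists i.
Qed.

(** Let [v] be of least degree in [J] outside [P].  If its degree were positive,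
    pseudo-division of the generator [g] of [P] by [v] would give [q * v] in [P]
    with [q] of smaller degree than [g], so that [q], and with it a multiple of
    [g] by a constant outside [P], would have all its coefficients in [P]. *)
Lemma prime_contraction P J :
    is_prime P -> is_ideal J -> P `<=` J ->
    (exists g, P g /\ exists i, ~ P (g`_i)%:P) ->
    (exists f, J f /\ ~ P f) ->
  exists c : R, J c%:P /\ ~ P c%:P.
Proof.
move=> prP idJ PJ exg exf; have [idP P1 PP] := prP.
have PC c k f : ~ P c%:P -> P (c ^+ k *: f) -> P f.
  by move=> nPc; rewrite -mul_polyC rmorphXn => /PP[] // /(prime_exp prP).
have PZ I c f : is_ideal I -> I f -> I (c *: f).
  by move=> idI If; rewrite -mul_polyC; apply: idealMl.
have PXn c k : P c%:P -> P (c *: 'X^k).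
  by move=> Pc; rewrite -mul_polyC; apply: idealMr.
have [g [Pg nlg small]] := prime_poly_generator prP exg.
have nzg : g != 0.
  by apply/eqP => g0; apply: nlg; rewrite g0 lead_coef0; case: idP.
have [v [Jv nPv] minv] := @exists_minimal _ (fun f => J f /\ ~ P f) (fun g => size g) exf.
have nzv : v != 0 by apply/eqP => v0; apply: nPv; rewrite v0; case: idP.
have nlv : ~ P (lead_coef v)%:P.
  move=> Pl; have: (size v <= size (tr v))%N.
    apply: minv; split; first by apply: idealB => //; apply/PJ/PXn.
    move=> Pt; apply: nPv; rewrite -(subrK (lead_coef v *: 'X^((size v).-1)) v).
    by apply: idealD => //; apply: PXn.
  by rewrite leqNgt size_tr.
have [sv1|sv1] := leqP (size v) 1.
  by exists (v`_0); rewrite -(size1_polyC sv1).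
have svg : (size v < size g)%N.
  rewrite ltnNge; apply/negP => sgv.
  have E := Pdiv.Idomain.divp_eq v g.
  have : (size v <= size (v %% g)%R)%N.
    have Er : v %% g = lead_coef g ^+ scalp v g *: v - v %/ g * g.
      by rewrite E addrC addKr.
    apply: minv; rewrite Er; split.
      apply: (idealB idJ); first exact: PZ.
      by apply: (idealMl _ idJ); apply: PJ.
    move=> Pr; apply: nPv; apply: (PC _ (scalp v g) _ nlg).
    rewrite -(subrK (v %/ g * g) (_ *: v)).
    by apply: idealD => //; apply: idealMl.
  by rewrite leqNgt (leq_trans _ sgv) // ltn_modp.
have E := Pdiv.Idomain.divp_eq g v.
set q := g %/ v in E; set r := g %% v in E; set k := scalp g v in E.
have Jr : J r.
  have -> : r = lead_coef v ^+ k *: g - q * v by rewrite E addrC addKr.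
  apply: (idealB idJ); first by apply: PZ => //; apply: PJ.
  exact: (idealMl _ idJ).
have srv : (size r < size v)%N by rewrite ltn_modp.
have Pr : P r.
  by apply: contrapT => nPr; move: srv; rewrite ltnNge minv.
have rc := small _ Pr (ltn_trans srv svg).
have Pq : P q.
  have : P (q * v).
    have -> : q * v = lead_coef v ^+ k *: g - r by rewrite E addrK.
    by apply: idealB => //; apply: PZ.
  by move/PP => [].
have qc : forall i, P (q`_i)%:P.
  apply: small => //; rewrite /q Pdiv.Idomain.size_divp //.
  rewrite -subn_gt0 subKn; first by rewrite -subn1 subn_gt0.
  by rewrite (leq_trans (leq_pred _)) // ltnW.
case: nlg; apply: (PC _ k _ nlv).
rewrite lead_coefE -mul_polyC -polyCM -coefZ E coefD coefM polyCD rmorph_sum /=.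
apply: idealD => //; apply: ideal_sum => // j _.
by rewrite polyCM; apply: idealMr.
Qed.

End PolyContraction.

(** * Unique factorization in polynomial rings *)

Definition divides (R : comNzRingType) (a b : R) := exists c, b = c * a.

Definition irreducible_elt (R : idomainType) (p : R) :=
  [/\ p != 0, p \isn't a GRing.unit
    & forall a b, p = a * b -> a \is a GRing.unit \/ b \is a GRing.unit].

Definition prime_elt (R : idomainType) (p : R) :=
  [/\ p != 0, p \isn't a GRing.unit
    & forall a b, divides p (a * b) -> divides p a \/ divides p b].

Definition is_ufd (R : idomainType) :=
  forall x : R, x != 0 -> exists u s,
    [/\ u \is a GRing.unit, forall p, p \in s -> prime_elt p
      & x = u * \prod_(p <- s) p].

Section Divides.

Variable R : idomainType.
Implicit Types a b c p : R.

Lemma divides_refl a : divides a a.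
Proof. by exists 1; rewrite mul1r. Qed.

Lemma divides_mull a b c : divides a b -> divides a (c * b).
Proof. by case=> d ->; exists (c * d); rewrite mulrA. Qed.

Lemma divides_mulr a b c : divides a b -> divides a (b * c).
Proof. by rewrite mulrC; apply: divides_mull. Qed.

Lemma dividesD a b c : divides a b -> divides a c -> divides a (b + c).
Proof. by case=> d -> [e ->]; exists (d + e); rewrite mulrDl. Qed.

Lemma dividesB a b c : divides a b -> divides a c -> divides a (b - c).
Proof. by case=> d -> [e ->]; exists (d - e); rewrite mulrBl. Qed.

Lemma divides_trans a b c : divides a b -> divides b c -> divides a c.
Proof. by case=> d -> [e ->]; exists (e * d); rewrite mulrA. Qed.

Lemma divides_unitl u a b : u \is a GRing.unit ->
  divides a b -> divides (u * a) b.
Proof. by move=> uu [c ->]; exists (c / u); rewrite mulrA divrK. Qed.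

Lemma prime_elt_unitl u p : u \is a GRing.unit ->
  prime_elt p -> prime_elt (u * p).
Proof.
move=> uu [nz nu pr]; have nzu : u != 0.
  by apply: contraTneq uu => ->; rewrite unitr0.
split; first by rewrite mulf_neq0.
  by rewrite unitrMr.
move=> a b /(divides_trans (divides_mull u (divides_refl p))) /pr.
by case=> /(divides_unitl uu); [left | right].
Qed.

Lemma irreducible_is_prime p : is_ufd R -> irreducible_elt p -> prime_elt p.
Proof.
move=> ufdR [nzp nup irr]; case: (ufdR p nzp) => u [[|q s] [uu sP Ep]].
  by move: nup; rewrite Ep big_nil mulr1 uu.
have prq : prime_elt q by apply: sP; rewrite mem_head.
move: Ep; rewrite big_cons mulrCA mulrC => Ep; rewrite Ep.
case: (irr _ _ Ep) => [/prime_elt_unitl|uq]; first exact.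
by case: prq => _; rewrite uq.
Qed.

(** Induction on the prime factors of [a]: a prime that also divides [b] is
    moved into the common factor, any other prime must divide [v]. *)
Lemma ufd_coprime_factors a b : is_ufd R -> a != 0 ->
  exists g a' b', [/\ a = g * a', b = g * b'
                   & forall u v, u * a' = v * b' -> divides a' v].
Proof.
move=> ufdR nza; case: (ufdR a nza) => w [s [uw sP Ea]].
rewrite {}Ea {a nza}; elim: s b sP => [|p s IH] b sP.
  exists 1, w, b; rewrite big_nil mulr1 !mul1r; split=> // u v _.
  by exists (v / w); rewrite divrK.
have [nzp _ prp] : prime_elt p by apply: sP; rewrite mem_head.
have {}sP q : q \in s -> prime_elt q by move=> qs; apply: sP; rewrite inE qs orbT.
rewrite big_cons mulrCA; have [[b1 Eb]|npb] := pselect (divides p b).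
  have [g [a' [b' [Ea Eb' H]]]] := IH b1 sP.
  exists (p * g), a', b'; split=> //; first by rewrite Ea mulrA.
  by rewrite Eb Eb' mulrC mulrA.
have [g [a' [b' [Ea Eb' H]]]] := IH b sP.
exists g, (p * a'), b'; split=> //; first by rewrite Ea mulrCA.
move=> u v E; have : divides p (v * b').
  by rewrite -E mulrCA; apply/divides_mulr/divides_refl.
case/prp => [[v1 Ev]|pb']; last by case: npb; rewrite Eb'; apply: divides_mull.
have : divides a' v1.
  apply: (H u); apply: (mulfI nzp).
  by rewrite mulrCA E Ev -mulrA mulrCA.
by case=> c Ec; exists c; rewrite Ev Ec -mulrA [a' * p]mulrC.
Qed.

(** Divide out the common factors of [a] and [b]: the relations of the coprime
    cofactors are the multiples of the exchange relation. *)
Lemma ufd_syzygy_principal a b : is_ufd R -> (a != 0) || (b != 0) ->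
  exists s t : R, ((s != 0) || (t != 0)) /\ forall u v,
    u * a + v * b = 0 <-> exists c, u = c * s /\ v = c * t.
Proof.
move=> ufdR; have key x y : x != 0 ->
    exists s t : R, t != 0 /\ forall u v,
    u * x + v * y = 0 <-> exists c, u = c * s /\ v = c * t.
  move=> nzx; have [g [x' [y' [Ex Ey H]]]] := ufd_coprime_factors y ufdR nzx.
  have nzg : g != 0 by apply: contraNneq nzx => g0; rewrite Ex g0 mul0r.
  have nzx' : x' != 0 by apply: contraNneq nzx => g0; rewrite Ex g0 mulr0.
  exists (- y'), x'; split=> // u v.
  have -> : (u * x + v * y = 0) <-> (u * x' = (- v) * y').
    rewrite Ex Ey mulrCA [v * _]mulrCA -mulrDr; split.
      move/eqP; rewrite mulf_eq0 (negbTE nzg) /= addr_eq0 => /eqP ->.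
      by rewrite mulNr.
    by move=> ->; rewrite mulNr addNr mulr0.
  split=> [E|[c [-> ->]]]; last by rewrite mulNr mulrN !mulNr mulrAC.
  have [c Ec] := H _ _ E; exists (- c); rewrite mulrNN mulNr -Ec opprK.
  by split=> //; apply: (mulIf nzx'); rewrite E Ec mulrAC.
have [nza _|] := boolP (a != 0).
  by have [s [t [nzt H]]] := key a b nza; exists s, t; rewrite nzt orbT.
rewrite negbK /= => /eqP a0 nzb; have [s [t [nzt H]]] := key b a nzb.
exists t, s; rewrite nzt; split=> // u v; rewrite addrC H.
by split=> -[c [? ?]]; exists c.
Qed.

End Divides.

Section GaussLemma.

Variable R : idomainType.
Implicit Types (f g p : {poly R}) (c : R).

Lemma divides_polyC c f : divides c%:P f <-> forall i, divides c f`_i.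
Proof.
split=> [[g ->] i|dv]; first by exists g`_i; rewrite coefMC.
have [q Eq] := choice dv; exists (\poly_(i < size f) q i).
apply/polyP => i; rewrite coefMC coef_poly; case: ltnP => [_|le]; first exact: Eq.
by rewrite mul0r nth_default.
Qed.

(** Remove leading terms divisible by [c] from both factors; if none is left,
    [c] cannot divide the product of the leading coefficients. *)
Lemma prime_polyC c : prime_elt c -> prime_elt c%:P.
Proof.
case=> nzc nuc pr; split; first by rewrite polyC_eq0.
  by rewrite poly_unitE coefC eqxx (negbTE nuc) andbF.
have trunc f : f != 0 -> divides c (lead_coef f) ->
    exists f', (size f' < size f)%N /\ divides c%:P (f - f').
  move=> nzf dc; exists (\poly_(i < (size f).-1) f`_i).
  have sf : (0 < size f)%N by rewrite size_poly_gt0.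
  split; first by rewrite -[X in (_ < X)%N](prednK sf) ltnS size_poly.
  apply/divides_polyC => i; rewrite coefB coef_poly; case: ltnP => [_|le].
    by rewrite subrr; exists 0; rewrite mul0r.
  rewrite subr0; move: le; rewrite leq_eqVlt => /predU1P[<-|lt] //.
  by rewrite nth_default; [exists 0; rewrite mul0r | rewrite -(prednK sf)].
move=> a b; have [n] := ubnP (size a + size b).
elim: n a b => // n IH a b; rewrite ltnS => le_n dab.
have [->|nza] := eqVneq a 0; first by left; exists 0; rewrite mul0r.
have [->|nzb] := eqVneq b 0; first by right; exists 0; rewrite mul0r.
have : divides c (lead_coef a * lead_coef b).
  by rewrite -lead_coefM lead_coefE; move: dab => /divides_polyC; apply.
case/pr => [/(trunc _ nza) [a' [sa da]]|/(trunc _ nzb) [b' [sb db]]].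
- have : divides c%:P (a' * b).
    by rewrite -(subKr a a') mulrBl; exact: (dividesB dab (divides_mulr b da)).
  case/IH; [by rewrite (leq_trans _ le_n) // ltn_add2r | | by right].
  by move=> da'; left; rewrite -(subrK a' a); apply: (dividesD da da').
- have : divides c%:P (a * b').
    by rewrite -(subKr b b') mulrBr; exact: (dividesB dab (divides_mull a db)).
  case/IH; [by rewrite (leq_trans _ le_n) // ltn_add2l | by left |].
  by move=> db'; right; rewrite -(subrK b' b); apply: (dividesD db db').
Qed.

Hypothesis ufdR : is_ufd R.

(** A constant can be cancelled from a product of two polynomials, one prime
    factor at a time, each going to one of the two factors. *)
Let cancel_const c f g p : c != 0 -> c%:P * f = g * p ->
  exists c1 c2 g' p', [/\ g = c1%:P * g', p = c2%:P * p' & f = g' * p'].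
Proof.
move=> nzc; case: (ufdR nzc) => u [s [uu sP ->]].
elim: s g p sP => [|q s IH] g p sP.
  rewrite big_nil mulr1 => E; exists u, 1, ((u^-1)%:P * g), p.
  rewrite !mul1r mulrA -polyCM divrr // mul1r; split=> //.
  by rewrite -mulrA -E mulrA -polyCM mulVr // mul1r.
have [nzq nuq prq] : prime_elt q%:P.
  by apply/prime_polyC/sP; rewrite mem_head.
have {}sP x : x \in s -> prime_elt x by move=> xs; apply: sP; rewrite inE xs orbT.
rewrite big_cons mulrCA polyCM -mulrA => E.
have : divides q%:P (g * p) by rewrite -E; apply/divides_mulr/divides_refl.
case/prq => -[h Eh].
  have [] := IH h p sP; first by apply: (mulfI nzq); rewrite E Eh mulrA [h * _]mulrC.
  move=> c1 [c2 [g' [p' [E1 E2 E3]]]]; exists (c1 * q), c2, g', p'.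
  by rewrite Eh E1 polyCM mulrAC.
have [] := IH g h sP; first by apply: (mulfI nzq); rewrite E Eh mulrA [RHS]mulrC.
move=> c1 [c2 [g' [p' [E1 E2 E3]]]]; exists c1, (c2 * q), g', p'.
by rewrite Eh E2 polyCM mulrAC.
Qed.

(** Gauss: an irreducible polynomial of positive degree stays irreducible
    over the field of fractions, where it generates a maximal ideal.  A member
    [g] of least degree of the ideal [(p, a)] plays the part of the greatest
    common divisor over the field of fractions. *)
Lemma irreducible_poly_prime p : irreducible_elt p -> prime_elt p.
Proof.
move=> irrp; have [nzp nup irr] := irrp.
have [sp1|sp1] := leqP (size p) 1.
  rewrite (size1_polyC sp1); apply/prime_polyC/irreducible_is_prime => //.
  split.
  - by move: nzp; rewrite {1}(size1_polyC sp1) polyC_eq0.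
  - apply: contraNN nup => uc; rewrite (size1_polyC sp1).
    exact: (rmorph_unit polyC).
  - move=> a b Eab; case: (irr a%:P b%:P).
    + by rewrite (size1_polyC sp1) Eab polyCM.
    + by rewrite poly_unitE coefC eqxx => /andP[_]; left.
    + by rewrite poly_unitE coefC eqxx => /andP[_]; right.
have not_unit f : (1 < size f)%N -> f \isn't a GRing.unit.
  by move=> sf; rewrite poly_unitE; case: eqP sf => // ->.
have cancel c f w : c != 0 -> c%:P * f = p * w -> divides p f.
  move=> nzc /(cancel_const nzc) [c1 [c2 [p' [w' [Ep Ew ->]]]]].
  apply: divides_mulr; rewrite Ep; case: (irr _ _ Ep) => [uc|up'].
    exact/divides_unitl/divides_refl.
  have nzp' : size p' = 1%N by move: up'; rewrite poly_unitE => /andP[/eqP].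
  move: sp1; rewrite Ep; have := size_polyMleq c1%:P p'.
  rewrite nzp' addn1 /= => le1 lt; have := leq_trans lt le1.
  by rewrite size_polyC; case: (_ == 0).
split=> // a b [w Ew]; have [pa|npa] := pselect (divides p a); first by left.
right; pose J := [set f | exists x y, f = x * p + y * a].
have JZ c f : J f -> J (c *: f).
  by case=> x [y ->]; exists (c *: x), (c *: y); rewrite scalerDr !scalerAl.
have JB f g q : J f -> J g -> J (f - q * g).
  case=> x [y ->] [x' [y' ->]]; exists (x - q * x'), (y - q * y').
  by rewrite mulrDr !mulrBl !mulrA opprD addrACA.
have Jp : J p by exists 1, 0; rewrite mul1r mul0r addr0.
have Ja : J a by exists 0, 1; rewrite mul1r mul0r add0r.
have [g [Jg nzg] ming] : exists2 g, J g /\ g != 0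
    & forall y, J y /\ y != 0 -> (size g <= size y)%N.
  by apply: exists_minimal; exists p.
have div_by_g f : J f -> exists c h, c != 0 /\ c%:P * f = g * h.
  move=> Jf; have E := Pdiv.Idomain.divp_eq f g.
  exists (lead_coef g ^+ scalp f g), (f %/ g).
  rewrite expf_neq0 ?lead_coef_eq0 // mul_polyC E; split=> //.
  have [->|nzr] := eqVneq (f %% g) 0; first by rewrite addr0 mulrC.
  have : (size g <= size (f %% g)%R)%N.
    apply: ming; split=> //.
    have -> : f %% g = lead_coef g ^+ scalp f g *: f - f %/ g * g.
      by rewrite E addrC addKr.
    by apply: JB => //; apply: JZ.
  by rewrite leqNgt ltn_modp nzg.
have [sg1|sg1] := leqP (size g) 1.
  have Eg := size1_polyC sg1; case: Jg => x [y Exy].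
  apply: (cancel g`_0 b (x * b + y * w)).
    by move: nzg; rewrite {1}Eg polyC_eq0.
  rewrite -Eg Exy mulrDl mulrDr -mulrA mulrCA; congr (_ + _).
  by rewrite -mulrA Ew mulrA [RHS]mulrC.
have [c [h [nzc Ec]]] := div_by_g p Jp.
have [c' [h' [nzc' Ec']]] := div_by_g a Ja.
have [c1 [c2 [g' [p' [Eg Eh Ep]]]]] := cancel_const nzc Ec.
case: npa; apply: (cancel c' _ (c1%:P * (p')^-1 * h')) => //.
rewrite Ec' Eg Ep -!mulrA; rewrite mulrCA; congr (_ * _).
case: (irr _ _ Ep) => [ug'|up'].
  suff : g \isn't a GRing.unit -> False by case; apply: not_unit.
  move=> _; move: sg1; rewrite Eg; have := size_polyMleq c1%:P g'.
  have -> : size g' = 1%N by move: ug'; rewrite poly_unitE => /andP[/eqP].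
  rewrite addn1 /= => le1 lt; have := leq_trans lt le1.
  by rewrite size_polyC; case: (_ == 0).
by rewrite [p' * (_ * _)]mulrCA; congr (_ * _); rewrite mulrA divrr ?mul1r.
Qed.

End GaussLemma.

(** * Polynomials in several variables *)

Lemma mpoly_morph_eq (K : idomainType) n (A : comNzRingType)
    (phi psi : {rmorphism {mpoly K[n]} -> A}) :
  (forall c, phi c%:MP = psi c%:MP) -> (forall i, phi 'X_i = psi 'X_i) ->
  phi =1 psi.
Proof.
move=> eqC eqX f; rewrite (mpolyE f) !rmorph_sum; apply: eq_bigr => m _.
rewrite -mul_mpolyC !rmorphM /= eqC mpolyXE_id !rmorph_prod; congr (_ * _).
by apply: eq_bigr => i _; rewrite !rmorphXn eqX.
Qed.

Section PolynomialIso.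

Variables (K : idomainType) (n : nat).

Local Notation R := {mpoly K[n]}.
Local Notation S := {mpoly K[n.+1]}.

(** The inverse of [muni]: the last variable becomes the indeterminate. *)
Definition mpoly_of_poly : {poly R} -> S :=
  horner_eval 'X_ord_max \o map_poly (@mwiden n K).

HB.instance Definition _ := GRing.RMorphism.on mpoly_of_poly.

Lemma mpoly_of_polyC c : mpoly_of_poly c%:P = mwiden c.
Proof. by rewrite /mpoly_of_poly /= /horner_eval map_polyC hornerC. Qed.

Lemma mpoly_of_polyX : mpoly_of_poly 'X = 'X_ord_max.
Proof. by rewrite /mpoly_of_poly /= /horner_eval map_polyX hornerX. Qed.

Lemma muni_X_max : muni 'X_ord_max = 'X :> {poly R}.
Proof.
rewrite muniE msuppX big_seq1 mcoeffX eqxx scale1r mnm1E eqxx.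
rewrite -mul_polyC (_ : [multinom _ | _ < _] = 0%MM) ?mpolyX0 ?mul1r //.
apply/mnmP => i; rewrite !mnmE -val_eqE /= gtn_eqF //.
Qed.

Lemma muni_X_widen i : muni 'X_(widen_ord (leqnSn n) i) = ('X_i)%:P :> {poly R}.
Proof.
rewrite muniE msuppX big_seq1 mcoeffX eqxx scale1r mnm1E.
rewrite -val_eqE /= ltn_eqF // -mul_polyC expr0 mulr1.
by congr ('X_[_])%:P; apply/mnmP => j; rewrite !mnmE -!val_eqE.
Qed.

Lemma mwiden_X i : mwiden 'X_i = 'X_(widen_ord (leqnSn n) i) :> S.
Proof. by rewrite mwidenX mnmwiden1. Qed.

Lemma ord_max_or_widen (i : 'I_n.+1) :
  i = ord_max \/ exists j, i = widen_ord (leqnSn n) j.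
Proof.
case: (unliftP ord_max i) => [j ->|->]; last by left.
by right; exists j; apply: val_inj; rewrite /= /bump leqNgt ltn_ord.
Qed.

Lemma muniK : cancel (@muni n K) mpoly_of_poly.
Proof.
apply: (mpoly_morph_eq (phi := mpoly_of_poly \o @muni n K) (psi := idfun)).
  by move=> c; rewrite /= muniC mpoly_of_polyC mwidenC.
move=> i /=; case: (ord_max_or_widen i) => [->|[j ->]].
  by rewrite muni_X_max mpoly_of_polyX.
by rewrite muni_X_widen mpoly_of_polyC mwiden_X.
Qed.

Lemma muni_mwiden c : muni (mwiden c) = c%:P :> {poly R}.
Proof.
move: c; apply: (mpoly_morph_eq (phi := @muni n K \o @mwiden n K) (psi := polyC)).
  by move=> c; rewrite /= mwidenC muniC.
by move=> i; rewrite /= mwiden_X muni_X_widen.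
Qed.

Lemma mpoly_of_polyK : cancel mpoly_of_poly (@muni n K).
Proof.
elim/poly_ind => [|p c IH]; first by rewrite !rmorph0.
rewrite !rmorphD !rmorphM /= IH mpoly_of_polyX muni_X_max.
by rewrite mpoly_of_polyC muni_mwiden.
Qed.

End PolynomialIso.

Lemma iso_prime_elt (A B : idomainType) (phi : {rmorphism A -> B})
    (psi : {rmorphism B -> A}) : cancel phi psi -> cancel psi phi ->
  forall p, (irreducible_elt (phi p) -> prime_elt (phi p)) ->
  irreducible_elt p -> prime_elt p.
Proof.
move=> phiK psiK p prP [nzp nup irr].
have unitE x : (phi x \is a GRing.unit) = (x \is a GRing.unit).
  by apply/idP/idP => [/(rmorph_unit psi)|/(rmorph_unit phi)]; rewrite ?phiK.
have divE a b : divides (phi a) (phi b) -> divides a b.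
  by case=> c Ec; exists (psi c); rewrite -(phiK b) Ec rmorphM phiK.
have [|_ _ pr] := prP.
  split; first by rewrite -(rmorph0 phi) (inj_eq (can_inj phiK)).
    by rewrite unitE.
  move=> a b Eab; have [] := irr (psi a) (psi b).
  - by rewrite -rmorphM -Eab phiK.
  - by rewrite -unitE psiK; left.
  - by rewrite -unitE psiK; right.
split=> // a b [c Ec]; have [] := pr (phi a) (phi b).
- by exists (phi c); rewrite -!rmorphM Ec.
- by move/divE; left.
- by move/divE; right.
Qed.

Lemma mpoly_size1_unit (K : fieldType) n (f : {mpoly K[n]}) :
  f != 0 -> (msize f <= 1)%N -> f \is a GRing.unit.
Proof.
move=> nzf /msize1_polyC E; move: nzf; rewrite {}E => nzf.
have nzc : f@_0 != 0 by apply: contraNneq nzf => ->; rewrite mpolyC0.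
apply/unitrP; exists ((f@_0)^-1)%:MP.
by rewrite -!mpolyCM mulVf // mulfV // mpolyC1.
Qed.

(** Factor by decreasing total degree; irreducible elements are prime by the
    Gauss lemma in the last variable. *)
Lemma mpoly_ufd (K : fieldType) n : is_ufd {mpoly K[n]}.
Proof.
elim: n => [|n IHn].
  move=> f nzf; exists f, [::]; rewrite big_nil mulr1; split=> //.
  apply: mpoly_size1_unit => //; rewrite msizeE; apply/bigmax_leqP_seq => m _ _.
  by rewrite mdegE big_ord0.
have irr_prime (p : {mpoly K[n.+1]}) : irreducible_elt p -> prime_elt p.
  apply: (@iso_prime_elt {mpoly K[n.+1]} {poly {mpoly K[n]}}
    (@muni n K) (@mpoly_of_poly K n)).
  - exact: muniK.
  - exact: mpoly_of_polyK.
  - exact: irreducible_poly_prime.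
move=> f; have [k] := ubnP (msize f); elim: k f => // k IH f.
rewrite ltnS => le_f nzf; have [uf|nuf] := boolP (f \is a GRing.unit).
  by exists f, [::]; rewrite big_nil mulr1.
have [irrf|] := pselect (irreducible_elt f).
  exists 1, [:: f]; rewrite unitr1 mul1r big_seq1; split=> // p.
  by rewrite inE => /eqP ->; apply: irr_prime.
move=> nirr; have [a [b [Ef nua nub]]] : exists a b,
    [/\ f = a * b, a \isn't a GRing.unit & b \isn't a GRing.unit].
  apply: contrapT => H; apply: nirr; split=> // a b Ef.
  have [|nua] := boolP (a \is a GRing.unit); first by left.
  have [|nub] := boolP (b \is a GRing.unit); first by right.
  by case: H; exists a, b.
move: nzf; rewrite Ef mulf_eq0 negb_or => /andP[nza nzb].
have big (g : {mpoly K[n.+1]}) : g != 0 -> g \isn't a GRing.unit -> (1 < msize g)%N.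
  by move=> nzg; apply: contraNltn => ?; apply: mpoly_size1_unit.
have /big/(_ nua) sa := nza; have /big/(_ nub) sb := nzb.
move: le_f; rewrite Ef msizeM // => le_f.
have [|u [s [uu sP Ea]]] := IH a _ nza.
  rewrite (leq_trans _ le_f) // -[X in (_ < X.-1)%N]addnC.
  by case: (msize b) sb => [|[|m]] // _; rewrite !addSn /= ltnS leq_addl.
have [|v [t [uv tP Eb]]] := IH b _ nzb.
  rewrite (leq_trans _ le_f) //.
  by case: (msize a) sa => [|[|m]] // _; rewrite !addSn /= ltnS leq_addl.
exists (u * v), (s ++ t); split; first by rewrite unitrM uu.
  by move=> p; rewrite mem_cat => /orP[/sP|/tP].
by rewrite big_cat Ea Eb mulrACA.
Qed.

(** * The Nullstellensatz *)

(** An ideal maximal among those avoiding the powers of [x] is prime.  The empty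
    set is admitted in the family so that the empty chain has a bound. *)
Lemma prime_avoiding_powers (A : comNzRingType) (Q : set A) x :
  is_ideal Q -> (forall k, ~ Q (x ^+ k)) ->
  exists P, [/\ is_prime P, Q `<=` P & ~ P x].
Proof.
move=> idQ Qx.
pose F (P : set A) := P = set0 \/
  [/\ is_ideal P, Q `<=` P & forall k, ~ P (x ^+ k)].
have [C CF totC|P [FP maxP]] := @Zorn_bigcup A F.
  have [[B CB B0]|all0] := pselect (exists2 B, C B & B !=set0); last first.
    left; apply/seteqP; split=> // u [B CB Bu]; case: all0; exists B => //.
    by exists u.
  have CI D u : C D -> D u -> [/\ is_ideal D, Q `<=` D & forall k, ~ D (x ^+ k)].
    by move=> CD Du; case: (CF D CD) => // D0; move: Du; rewrite D0.
  have [u0 Bu0] := B0; have [idB QB Bx] := CI _ _ CB Bu0.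
  right; split=> [|q Qq|k [D CD Dx]].
  - split; first by exists B => //; case: idB.
    + move=> u v [D CD Du] [E CE Ev]; have [idD _ _] := CI _ _ CD Du.
      have [idE _ _] := CI _ _ CE Ev; case: (totC D E CD CE) => sub.
        by exists E => //; apply: idealD => //; apply: sub.
      by exists D => //; apply: idealD => //; apply: sub.
    + move=> a u [D CD Du]; have [idD _ _] := CI _ _ CD Du.
      by exists D => //; apply: idealMl.
  - by exists B => //; apply: QB.
  - by have [_ _ /(_ k)] := CI _ _ CD Dx.
have {}FP : [/\ is_ideal P, Q `<=` P & forall k, ~ P (x ^+ k)].
  case: FP => // P0; case: (maxP Q); last by right; split.
  rewrite P0 properEneq; split=> //; apply/eqP => Q0.
  by case: idQ => Q00 _ _; move: Q00; rewrite -Q0.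
have [idP QP Px] := FP; exists P; split=> //; last by have := Px 1%N; rewrite expr1.
split=> //; first by have := Px 0%N; rewrite expr0.
have ext u : ~ P u -> exists k a p, P p /\ x ^+ k = p + a * u.
  move=> nPu; apply: contrapT => H.
  pose J := [set y | exists p a, P p /\ y = p + a * u].
  apply: (maxP J); last right.
    rewrite properEneq; split; last first.
      by move=> p Pp; exists p, 0; rewrite mul0r addr0.
    apply/eqP => PJ; apply: nPu; rewrite PJ; exists 0, 1.
    by rewrite mul1r add0r; split=> //; case: idP.
  split.
  - exact: is_ideal_add.
  - by move=> q /QP Pq; exists q, 0; rewrite mul0r addr0.
  - by move=> k [p [a [Pp E]]]; apply: H; exists k, a, p.
move=> u v Puv; have [|nPu] := pselect (P u); first by left.
have [|nPv] := pselect (P v); first by right.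
have [k [a [p [Pp Ep]]]] := ext u nPu; have [l [b [q [Pq Eq]]]] := ext v nPv.
case: (Px (k + l)%N); rewrite exprD Ep Eq mulrDl; apply: idealD => //.
  exact: idealMr.
rewrite mulrDr; apply: idealD => //; first exact: idealMl.
by rewrite mulrACA; apply: idealMl.
Qed.

Section Nullstellensatz.

Variable K : closedFieldType.

(** Extending points of the ring of constants by one coordinate.  Either [P] is
    extended from its constants, and it suffices to keep a coefficient of [f]
    nonzero; or [P] has one generator [g] over the field of fractions, and the
    new coordinate is a root of [g], while a nonzero constant [h] in the ideal
    [P + (f)] keeps [f] nonzero there. *)
Lemma point_lift (R : idomainType) (T : Type) (ev : T -> {rmorphism R -> K})
    (P : set {poly R}) f : is_prime P -> ~ P f ->
  (forall c, ~ P c%:P ->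
     exists t, (forall d, P d%:P -> ev t d = 0) /\ ev t c != 0) ->
  exists t z, (forall g, P g -> (map_poly (ev t) g).[z] = 0) /\
    (map_poly (ev t) f).[z] != 0.
Proof.
move=> prP nPf IH; have [idP _ PP] := prP.
have [ext|H] := pselect (exists g, P g /\ exists i, ~ P (g`_i)%:P); last first.
  have [c [nPc [i Ec]]] : exists c, ~ P c%:P /\ exists i, c = f`_i.
    apply: contrapT => H'; apply: nPf; rewrite -[f]coefK poly_def.
    apply: ideal_sum => // i _; rewrite -mul_polyC; apply: idealMr => //.
    by apply: contrapT => nPi; apply: H'; exists f`_i; split=> //; exists i.
  have [t [t0 nzct]] := IH c nPc.
  have : map_poly (ev t) f != 0.
    by apply: contraNneq nzct => /polyP/(_ i); rewrite coef_map coef0 Ec => ->.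
  case/closed_nonrootP => z nz; exists t, z; split=> // g Pg.
  suff -> : map_poly (ev t) g = 0 by rewrite horner0.
  apply/polyP => j; rewrite coef_map coef0; apply: t0.
  by apply: contrapT => nP; apply: H; exists g; split=> //; exists j.
have [g [Pg nlg small]] := prime_poly_generator prP ext.
pose J := [set q | exists p a, P p /\ q = p + a * f].
have [h [[p [a [Pp Eh]]] nPh]] : exists c, J c%:P /\ ~ P c%:P.
  apply: prime_contraction => //; first exact: is_ideal_add.
  - by move=> q Pq; exists q, 0; rewrite mul0r addr0.
  - by exists f; split=> //; exists 0, 1; rewrite mul1r add0r; split=> //; case: idP.
have [t [t0 nzt]] : exists t,
    (forall d, P d%:P -> ev t d = 0) /\ ev t (lead_coef g * h) != 0.
  by apply: IH; rewrite polyCM => /PP[].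
move: nzt; rewrite rmorphM /= mulf_eq0 negb_or => /andP[nzl nzh].
have sg : size (map_poly (ev t) g) = size g by rewrite size_poly_eq.
have : size (map_poly (ev t) g) != 1%N.
  rewrite sg; apply/eqP => sg1; apply: nlg; rewrite lead_coefE sg1 /=.
  by rewrite -(size1_polyC _) ?sg1.
case/closed_rootP => z /rootP gz.
have vanish u : P u -> (map_poly (ev t) u).[z] = 0.
  move=> Pu; have := Pdiv.Idomain.divp_eq u g.
  set q := u %/ g; set r := u %% g => E.
  have Pr : P r.
    have -> : r = lead_coef g ^+ scalp u g *: u - q * g by rewrite E addrC addKr.
    apply: (idealB idP); last exact: (idealMl _ idP).
    by rewrite -mul_polyC; apply: (idealMl _ idP).
  have nzg : g != 0.
    by apply/eqP => g0; apply: nlg; rewrite g0 lead_coef0; case: idP.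
  have sr : (size r < size g)%N by rewrite ltn_modp.
  have r0 : map_poly (ev t) r = 0.
    by apply/polyP => j; rewrite coef_map coef0; apply/t0/small.
  have /(congr1 (fun w => (map_poly (ev t) w).[z])) := E.
  rewrite rmorphD /= r0 addr0 rmorphM /= hornerM gz mulr0 map_polyZ hornerZ.
  move/eqP; rewrite mulf_eq0 rmorphXn expf_eq0 /= (negbTE nzl) andbF /=.
  by move/eqP.
exists t, z; split=> //; apply: contraNneq nzh => fz.
have /(congr1 (fun w => (map_poly (ev t) w).[z])) := Eh.
by rewrite map_polyC hornerC rmorphD rmorphM /= hornerD hornerM fz mulr0 addr0 vanish // => ->.
Qed.

Lemma meval_muni n (v : 'I_n -> K) z (f : {mpoly K[n.+1]}) :
  f.@[fun i => oapp v z (unlift ord_max i)] = (map_poly (meval v) (muni f)).[z].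
Proof.
move: f.
apply: (mpoly_morph_eq (phi := meval (fun i => oapp v z (unlift ord_max i)))
   (psi := horner_eval z \o map_poly (meval v) \o @muni n K)).
  by move=> c; rewrite /= /horner_eval muniC map_polyC hornerC mevalC /= mevalC.
move=> i; rewrite /= /horner_eval mevalXU.
case: (ord_max_or_widen i) => [->|[j ->]].
  by rewrite unlift_none muni_X_max map_polyX hornerX.
rewrite muni_X_widen map_polyC hornerC /= mevalXU.
have -> : widen_ord (leqnSn n) j = lift ord_max j.
  by apply: val_inj; rewrite /= /bump leqNgt ltn_ord.
by rewrite liftK.
Qed.

(** Induction on the number of variables, with [point_lift] for the last one. *)
Theorem nullstellensatz n (P : set {mpoly K[n]}) f : is_prime P -> ~ P f ->
  exists v : 'I_n -> K, (forall g, P g -> g.@[v] = 0) /\ f.@[v] != 0.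
Proof.
elim: n P f => [|n IH] P f prP nPf; have [idP P1 PP] := prP.
  have unit_or0 (g : {mpoly K[0]}) : g = 0 \/ g \is a GRing.unit.
    have [->|nzg] := eqVneq g 0; first by left.
    right; apply: mpoly_size1_unit => //; rewrite msizeE.
    by apply/bigmax_leqP_seq => m _ _; rewrite mdegE big_ord0.
  exists (fun=> 0); split=> [g Pg|].
    case: (unit_or0 g) => [->|ug]; first by rewrite meval0.
    by case: P1; rewrite -(divrr ug); apply: idealMr.
  case: (unit_or0 f) => [f0|uf]; first by case: nPf; rewrite f0; case: idP.
  by have := rmorph_unit (meval (fun=> 0)) uf; rewrite unitfE.
pose Pp : set {poly {mpoly K[n]}} := [set q | P (mpoly_of_poly q)].
have prPp : is_prime Pp by exact:
  (@is_prime_preim {poly {mpoly K[n]}} {mpoly K[n.+1]} (@mpoly_of_poly K n) P prP).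
pose p0 : set {mpoly K[n]} := [set c | Pp c%:P].
have prp0 : is_prime p0 by exact:
  (@is_prime_preim {mpoly K[n]} {poly {mpoly K[n]}} (@polyC {mpoly K[n]}) Pp prPp).
have PE g : P g <-> Pp (muni g) by rewrite /Pp /= muniK.
have nPpf : ~ Pp (muni f) by move=> Pf; apply: nPf; apply: (PE f).2.
pose ev (v : 'I_n -> K) : {rmorphism {mpoly K[n]} -> K} := meval v.
have [|v [z [v0 nz]]] := @point_lift {mpoly K[n]} _ ev Pp (muni f) prPp nPpf.
  by move=> c nPc; apply: (IH p0 c prp0 nPc).
exists (fun i => oapp v z (unlift ord_max i)); split.
  by move=> g Pg; rewrite meval_muni; apply: v0; apply: (PE g).1.
by rewrite meval_muni; apply: nz.
Qed.

(** The projective form: away from the origin [Q] has no zeros, so no prime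
    over [Q] can avoid a variable. *)
Lemma projective_nullstellensatz n (Q : set {mpoly K[n]}) : is_ideal Q ->
  (forall v : 'I_n -> K, (exists i, v i != 0) -> exists2 D, Q D & D.@[v] != 0) ->
  forall i, exists N, Q ('X_i ^+ N).
Proof.
move=> idQ QD i; apply: contrapT => H.
have [|P [prP QP nPx]] := @prime_avoiding_powers _ Q 'X_i idQ.
  by move=> k Qk; apply: H; exists k.
have [v [v0 nzi]] := nullstellensatz prP nPx.
have [|D QD' nzD] := QD v; first by exists i; rewrite -(mevalXU v).
by move: nzD; rewrite v0 ?eqxx //; apply: QP.
Qed.

End Nullstellensatz.

(** * Depth: ideals with two generators are saturated *)

Lemma mpoly_alg_ind (K : comNzRingType) n (P : {mpoly K[n]} -> Prop) :
  (forall c, P c%:MP) -> (forall i, P 'X_i) ->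
  (forall f g, P f -> P g -> P (f + g)) ->
  (forall f g, P f -> P g -> P (f * g)) -> forall f, P f.
Proof.
move=> PC PX PD PM f; rewrite (mpolyE f).
have P0 : P 0 by rewrite -mpolyC0.
have P1 : P 1 by rewrite -mpolyC1.
apply: (big_ind P) => // m _; rewrite -mul_mpolyC; apply: (PM _ _) => //.
rewrite mpolyXE_id; apply: (big_ind P) => // i _.
by elim: (m i) => [|k IH]; [rewrite expr0 | rewrite exprS; apply: (PM _ _)].
Qed.

Section ZeroVariable.

Variables (K : fieldType) (n : nat).
Local Notation S := {mpoly K[n]}.
Implicit Types (i j : 'I_n) (f g : S).

(** Reduction modulo the variable [X_i], as an endomorphism. *)
Definition zero_var i : S -> S :=
  comp_mpoly [tuple if j == i then 0 else 'X_j | j < n].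

HB.instance Definition _ i := GRing.RMorphism.on (zero_var i).

Lemma zero_varD i : {morph zero_var i : f g / f + g}.
Proof. exact: rmorphD. Qed.

Lemma zero_varM i : {morph zero_var i : f g / f * g}.
Proof. exact: rmorphM. Qed.

Lemma zero_var0 i : zero_var i 0 = 0.
Proof. exact: rmorph0. Qed.

Lemma zero_varC i c : zero_var i c%:MP = c%:MP.
Proof. exact: comp_mpolyC. Qed.

Lemma zero_varX i j : zero_var i 'X_j = if j == i then 0 else 'X_j.
Proof. by rewrite /zero_var /comp_mpoly mmapX mmap1U tnth_mktuple. Qed.

Lemma zero_var_divides i f : divides 'X_i (f - zero_var i f).
Proof.
elim/mpoly_alg_ind: f => [c|j|f g|f g].
- by rewrite zero_varC subrr; exists 0; rewrite mul0r.
- rewrite zero_varX; case: eqP => [->|_].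
    by rewrite subr0; exists 1; rewrite mul1r.
  by rewrite subrr; exists 0; rewrite mul0r.
- by rewrite rmorphD opprD addrACA; apply: dividesD.
- move=> df dg; rewrite rmorphM.
  have -> : f * g - zero_var i f * zero_var i g =
    f * (g - zero_var i g) + (f - zero_var i f) * zero_var i g.
    by rewrite mulrBr mulrBl addrA subrK.
  by apply: dividesD; [apply: (divides_mull _ dg) | apply: (divides_mulr _ df)].
Qed.

Lemma zero_var_eq0 i f : zero_var i f = 0 <-> divides 'X_i f.
Proof.
split=> [f0|[q ->]]; last by rewrite rmorphM /= zero_varX eqxx mulr0.
by have := zero_var_divides i f; rewrite f0 subr0.
Qed.

Lemma zero_varK i f : zero_var i (zero_var i f) = zero_var i f.
Proof.
have /zero_var_eq0/eqP := zero_var_divides i f.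
by rewrite rmorphB subr_eq0 => /eqP.
Qed.

Lemma zero_var2_divides i j f : zero_var j (zero_var i f) = 0 ->
  exists a b, f = a * 'X_i + b * 'X_j.
Proof.
move=> /zero_var_eq0[b Eb]; have [a Ea] := zero_var_divides i f.
by exists a, b; rewrite -Eb -Ea subrK.
Qed.

Lemma mpolyX_neq0 i : 'X_i != 0 :> S.
Proof. by rewrite -msize_poly_eq0 msizeX. Qed.

Lemma mulX_divides i j f g : i != j -> 'X_j * f = 'X_i * g -> divides 'X_i f.
Proof.
move=> nij E; apply/zero_var_eq0; apply: (mulfI (mpolyX_neq0 j)).
have := congr1 (zero_var i) E.
by rewrite !rmorphM /= !zero_varX eqxx eq_sym (negbTE nij) mul0r mulr0.
Qed.

End ZeroVariable.

Section KoszulDepth.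

Variables (R : idomainType) (X Y Z : R).
Hypotheses (ufdR : is_ufd R) (nzX : X != 0).
Hypothesis reg2 : forall a b, Y * a = X * b -> divides X a.
Hypothesis reg3 : forall a b c, Z * a = X * b + Y * c ->
  exists b' c', a = X * b' + Y * c'.

Let koszul_cycle (p q r : R) :
  Z * (Y * p - X * q) - Y * (Z * p - X * r) + X * (Z * q - Y * r) = 0.
Proof. by ring. Qed.

(** The relations of [h1] and [h2] are the multiples of one pair, so this is
    the exactness of the Koszul complex of a regular sequence: expressing
    [X * f] and [Y * f] by [h1] and [h2] gives a relation [Y * u - X * u'],
    whose multiplier is then a combination of [X] and [Y]. *)
Lemma socle_two_generated (h1 h2 f : R) :
  (exists u v, X * f = u * h1 + v * h2) ->
  (exists u v, Y * f = u * h1 + v * h2) ->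
  (exists u v, Z * f = u * h1 + v * h2) ->
  exists u v, f = u * h1 + v * h2.
Proof.
move=> [ux [vx Ex]] [uy [vy Ey]] [uz [vz Ez]].
have [/andP[/eqP h10 /eqP h20]|] := boolP ((h1 == 0) && (h2 == 0)).
  exists 0, 0; apply: (mulfI nzX).
  by rewrite Ex h10 h20 !mulr0 addr0 mulr0.
rewrite negb_and => /(ufd_syzygy_principal ufdR) [s [t [nzst syz]]].
have rel I J u v u' v' : I * f = u * h1 + v * h2 -> J * f = u' * h1 + v' * h2 ->
    exists c, J * u - I * u' = c * s /\ J * v - I * v' = c * t.
  move=> Ei Ej; apply/syz; rewrite !mulrBl -!mulrA addrACA -opprD -!mulrDr.
  by rewrite -Ei -Ej mulrCA subrr.
have [a [Eau Eav]] := rel _ _ _ _ _ _ Ex Ey.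
have [b [Ebu Ebv]] := rel _ _ _ _ _ _ Ex Ez.
have [c [Ecu Ecv]] := rel _ _ _ _ _ _ Ey Ez.
have Kz : Z * a - Y * b + X * c = 0.
  have mull w :
      (Z * a - Y * b + X * c) * w = Z * (a * w) - Y * (b * w) + X * (c * w).
    by rewrite mulrDl mulrBl !mulrA.
  case/orP: nzst => nz; apply: (mulIf nz); rewrite mul0r mull.
    by rewrite -Eau -Ebu -Ecu koszul_cycle.
  by rewrite -Eav -Ebv -Ecv koszul_cycle.
have [q [p Ea]] : exists q p, a = X * q + Y * p.
  apply: (reg3 (b := - c) (c := b)); apply/eqP.
  by rewrite mulrN addrC -subr_eq0 opprB addrA addrAC Kz.
have reduce u u' w : Y * u - X * u' = a * w -> exists d, u = p * w + d * X.
  move=> E; have [|d Ed] := @reg2 (u - p * w) (u' + q * w).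
    by rewrite mulrBr -[Y * u](subrK (X * u')) E Ea; ring.
  by exists d; rewrite -Ed addrC subrK.
have [d Ed] := reduce _ _ _ Eau; have [e Ee] := reduce _ _ _ Eav.
have Est : s * h1 + t * h2 = 0 by apply/syz; exists 1; rewrite !mul1r.
exists d, e; apply: (mulfI nzX); rewrite Ex Ed Ee.
have -> : (p * s + d * X) * h1 + (p * t + e * X) * h2 =
  p * (s * h1 + t * h2) + X * (d * h1 + e * h2) by ring.
by rewrite Est mulr0 add0r.
Qed.

End KoszulDepth.

Section Saturation.

Variable K : fieldType.
Local Notation S := {mpoly K[3]}.

Lemma variables_socle (h1 h2 f : S) :
  (forall i, exists u v : S, 'X_i * f = u * h1 + v * h2) ->
  exists u v : S, f = u * h1 + v * h2.
Proof.
move=> Hf; pose i0 : 'I_3 := inord 0; pose i1 : 'I_3 := inord 1.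
pose i2 : 'I_3 := inord 2.
have [n01 n02 n12] : [/\ i0 != i1, i0 != i2 & i1 != i2].
  by rewrite -!val_eqE /= !inordK.
apply: (@socle_two_generated S 'X_i0 'X_i1 'X_i2 (@mpoly_ufd K 3)).
- exact: mpolyX_neq0.
- by move=> a b; apply: mulX_divides.
- move=> a b c E; have [|p [q Eq]] := @zero_var2_divides K 3 i0 i1 a.
    apply: (mulfI (mpolyX_neq0 K i2)); rewrite mulr0.
    have := congr1 (zero_var i1 \o zero_var i0) E.
    rewrite /= zero_varD !zero_varM !zero_varX eqxx (eq_sym i2 i0) (negbTE n02).
    rewrite (eq_sym i1 i0) (negbTE n01) mul0r add0r !zero_varM !zero_varX eqxx.
    by rewrite (eq_sym i2) (negbTE n12) mul0r.
  by exists p, q; rewrite Eq mulrC [q * _]mulrC.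
- exact: Hf.
- exact: Hf.
- exact: Hf.
Qed.

(** Induction on the sum of the exponents: the products of [f] by the variables
    have smaller exponents, so they already lie in the ideal. *)
Lemma saturated_two_generated (h1 h2 f : S) :
  (forall i, exists N (u v : S), 'X_i ^+ N * f = u * h1 + v * h2) ->
  exists u v : S, f = u * h1 + v * h2.
Proof.
move=> /choice [N HN]; have [k] := ubnP (\sum_i N i).
elim: k f N HN => // k IH f N HN; rewrite ltnS => le_k.
have [[i Ni0]|nN0] := pselect (exists i, N i = 0%N).
  by have := HN i; rewrite Ni0 expr0 mul1r.
have N_gt0 i : (0 < N i)%N.
  by rewrite lt0n; apply/eqP => Ni0; apply: nN0; exists i.
apply: variables_socle => j.
apply: (IH _ (fun i => if i == j then (N i).-1 else N i)) => [i|].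
  case: eqP => [->|_].
    by have := HN j; rewrite -[in 'X_j ^+ N j](prednK (N_gt0 j)) exprSr mulrA.
  have [u [v E]] := HN i; exists ('X_j * u), ('X_j * v).
  by rewrite mulrCA E mulrDr !mulrA.
apply: leq_trans le_k; rewrite (bigD1 j) //= [X in (_ < X)%N](bigD1 j) //= eqxx.
rewrite -[in X in (_ < X)%N](prednK (N_gt0 j)) addSn ltnS leq_add2l.
by apply: leq_sum => i /negbTE ->.
Qed.

End Saturation.

(** * Standard bases *)

Section Graded.

Variable (K : fieldType).
Local Notation S := (poly3 K).
Implicit Types (f g h q : S) (B s : seq S) (I : set S) (d e k : nat).

(** [msize] is one more than the degree. *)
Definition pdeg g := (msize g).-1.

Lemma form_homog g : Defs.form g -> g \is (pdeg g).-homog.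
Proof. by case=> d /dhomog_msize. Qed.

Lemma pdegE g d : g != 0 -> g \is d.-homog -> pdeg g = d.
Proof. by move=> nzg hg; apply: (dhomog_uniq nzg (dhomog_msize hg) hg). Qed.

Lemma homog0E f : f \is 0.-homog -> f = (f@_0)%:MP.
Proof.
move=> hf; apply: msize1_polyC; rewrite msizeE; apply/bigmax_leqP_seq => m mf _.
by rewrite (dhomog_mf hf mf).
Qed.

Lemma pihomogM_homog f g d e : g \is e.-homog ->
  pihomog mdeg (d + e) (f * g) = pihomog mdeg d f * g.
Proof.
move=> hg; have Ef := pihomog_partitionE (leqnn (msize f)).
rewrite {1}Ef mulr_suml raddf_sum /=.
have E (i : 'I_(msize f)) : pihomog mdeg (d + e) (pihomog mdeg i f * g) =
    if i == d :> nat then pihomog mdeg d f * g else 0.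
  have hi : pihomog mdeg i f * g \is (i + e).-homog.
    by apply: dhomogM => //; apply: pihomogP.
  case: eqP => [->|ne]; first by rewrite pihomog_dE //; apply/dhomogM/hg/pihomogP.
  by apply: pihomog_ne0 hi; rewrite eqn_add2r; apply/eqP.
rewrite (eq_bigr _ (fun i _ => E i)); have [lt|le] := ltnP d (msize f).
  by rewrite (bigD1 (Ordinal lt)) //= eqxx big1 ?addr0 // => i /negbTE; rewrite -val_eqE /= => ->.
rewrite big1 => [|i _]; last by rewrite ltn_eqF // (leq_trans (ltn_ord i)).
rewrite pihomogE big_seq_cond big_pred0 ?mul0r // => m.
apply/negbTE; rewrite negb_and -implybE; apply/implyP => /msize_mdeg_lt lt.
by rewrite ltn_eqF // (leq_trans lt).
Qed.

Lemma pihomogM_low f g d e : g \is e.-homog -> (d < e)%N ->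
  pihomog mdeg d (f * g) = 0.
Proof.
move=> hg lt; rewrite {1}(pihomog_partitionE (leqnn (msize f))) mulr_suml raddf_sum /=.
rewrite big1 // => i _; have hi : pihomog mdeg i f * g \is (i + e).-homog.
  by apply: dhomogM => //; apply: pihomogP.
by apply: pihomog_ne0 hi; rewrite gtn_eqF // (leq_trans lt) // leq_addl.
Qed.

(** Take the components of degree [d] on both sides: that of [r g * g] is the
    component of degree [d - pdeg g] of [r g], multiplied by [g]. *)
Lemma homog_combination s h d (r : S -> S) :
  (forall g, g \in s -> Defs.form g) -> h \is d.-homog ->
  h = \sum_(g <- s) r g * g ->
  exists t : S -> S, h = \sum_(g <- s) t g * g /\
    forall g, ((pdeg g <= d)%N -> t g \is (d - pdeg g).-homog) /\
      ((d < pdeg g)%N -> t g = 0).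
Proof.
move=> sf hh Eh.
exists (fun g => if (pdeg g <= d)%N then pihomog mdeg (d - pdeg g) (r g) else 0).
split=> [|g]; last by case: leqP => // _; split=> // _; apply: pihomogP.
rewrite -(pihomog_dE hh) {1}Eh raddf_sum /= big_seq [RHS]big_seq.
apply: eq_bigr => g /sf/form_homog hg; case: leqP => [le|lt].
  by rewrite -{1}(subnK le) pihomogM_homog.
by rewrite (pihomogM_low _ hg lt) mul0r.
Qed.

Lemma lower_part0 I d : lower_part I d 0.
Proof.
case: d => [//|d]; exists 0%N, (fun=> 0), (fun=> 0).
by split=> [[]|[]|] //; rewrite big_ord0.
Qed.

Lemma lower_partD I d f g :
  lower_part I d f -> lower_part I d g -> lower_part I d (f + g).
Proof.
case: d => [|d] /=; first by move=> -> ->; rewrite addr0.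
move=> [n [a [l [Ha Hl ->]]]] [m [b [k [Hb Hk ->]]]].
exists (n + m)%N, (fun i => match split i with inl j => a j | inr j => b j end),
  (fun i => match split i with inl j => l j | inr j => k j end).
split=> [i|i|]; try by case: (split i).
rewrite big_split_ord; congr (_ + _); apply: eq_bigr => i _.
  by rewrite (unsplitK (inl i)).
by rewrite (unsplitK (inr i)).
Qed.

Lemma lower_partZ I d c f : lower_part I d f -> lower_part I d (c *: f).
Proof.
case: d => [|d] /=; first by move=> ->; rewrite scaler0.
move=> [n [a [l [Ha Hl ->]]]]; exists n, a, (fun i => c *: l i); split=> // [i|].
  exact: dhomogZ.
by rewrite scaler_sumr; apply: eq_bigr => i _; rewrite scalerAr.
Qed.

Lemma lower_partN I d f : lower_part I d f -> lower_part I d (- f).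
Proof. by rewrite -scaleN1r; apply: lower_partZ. Qed.

Lemma lower_partB I d f g :
  lower_part I d f -> lower_part I d g -> lower_part I d (f - g).
Proof. by move=> lf /lower_partN; apply: lower_partD. Qed.

Lemma lower_part_sum I d (T : eqType) (r : seq T) (P : pred T) (F : T -> S) :
  (forall i, i \in r -> P i -> lower_part I d (F i)) ->
  lower_part I d (\sum_(i <- r | P i) F i).
Proof.
move=> H; rewrite big_seq_cond; apply: big_ind => [||i /andP[/H]]; last exact.
  exact: lower_part0.
by move=> ? ?; apply: lower_partD.
Qed.

(** Peel one variable off each monomial of [q]. *)
Lemma lower_part_mul I q g k e : is_ideal I -> (0 < k)%N -> q \is k.-homog ->
  component I e g -> lower_part I (k + e) (q * g).
Proof.
move=> idI k0 hq [Ig hg]; rewrite {1}(mpolyE q) mulr_suml.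
apply: lower_part_sum => m mq _; rewrite -scalerAl; apply: lower_partZ.
have Em : mdeg m = k := dhomog_mf hq mq; have [i mi] : exists i, (0 < m i)%N.
  apply: contrapT => H; move: k0; rewrite -Em mdegE big1 // => i _.
  by apply/eqP; rewrite -leqn0 leqNgt; apply/negP => mi; apply: H; exists i.
have Um : (U_(i) <= m)%MM by rewrite lep1mP -lt0n.
rewrite -(submK Um) mpolyXD mulrC -(prednK k0) addSn /=.
exists 1%N, (fun=> g * 'X_[m - U_(i)]), (fun=> 'X_i); split=> [_|_|].
- split; first exact: idealMr.
  rewrite addnC; apply: dhomogM => //; rewrite dhomogX /=.
  have := mdegD (m - U_(i)) U_(i); rewrite (submK Um) Em mdeg1 addn1.
  by rewrite -[in X in X -> _](prednK k0) => -[->].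
- by rewrite dhomogX /= mdeg1.
- by rewrite big_ord1 mulrA.
Qed.

(** Coefficients indexed by the members of [s] instead of their positions, so
    that sums can be compared along sublists and images of [s]. *)
Lemma basis_mod_lowerP I d s : uniq s -> basis_mod_lower I d s <->
  [/\ forall f, f \in s -> component I d f,
      forall f, component I d f -> exists c : S -> K,
        lower_part I d (f - \sum_(g <- s) c g *: g)
    & forall c : S -> K, lower_part I d (\sum_(g <- s) c g *: g) ->
        forall g, g \in s -> c g = 0].
Proof.
move=> us.
have toS (c : 'I_(size s) -> K) : exists c' : S -> K,
    (forall i : 'I_(size s), c' s`_i = c i) /\ \sum_(i < size s) c i *: s`_i = \sum_(g <- s) c' g *: g.
  exists (fun g => oapp c 0 (insub (index g s))).
  have E (i : 'I_(size s)) : oapp c 0 (insub (index s`_i s)) = c i.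
    by rewrite (index_uniq _ (ltn_ord i) us) valK.
  by split=> //; rewrite (big_nth 0) big_mkord; apply: eq_bigr => i _; rewrite E.
have ofS (c : S -> K) :
    \sum_(g <- s) c g *: g = \sum_(i < size s) c s`_i *: s`_i.
  by rewrite (big_nth 0) big_mkord.
split=> -[sI gen ind]; split=> // [f /gen [c]|c].
- by have [c' [_ ->]] := toS c; exists c'.
- rewrite ofS => /(ind (fun i => c s`_i)) H g gs.
  by have := H (Ordinal (etrans (index_mem g s) gs)); rewrite /= nth_index.
- by rewrite ofS => H; exists (fun i => c s`_i).
- have [c' [Ec' ->]] := toS c; move/ind => H i; rewrite -Ec'; apply: H.
  exact: mem_nth.
Qed.

End Graded.

Section StandardBases.

Variable (K : fieldType).
Local Notation S := (poly3 K).
Implicit Types (f g h q : S) (B s : seq S) (I : set S) (d e k : nat).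

Lemma in_degree_uniq B d : uniq B -> uniq (in_degree B d).
Proof. exact: filter_uniq. Qed.

Lemma mem_in_degree B d f : (f \in in_degree B d) = (f \is d.-homog) && (f \in B).
Proof. by rewrite mem_filter. Qed.

Lemma standard_basisP I B d : standard_basis I B ->
  [/\ forall f, f \in in_degree B d -> component I d f,
      forall f, component I d f -> exists c : S -> K,
        lower_part I d (f - \sum_(g <- in_degree B d) c g *: g)
    & forall c : S -> K, lower_part I d (\sum_(g <- in_degree B d) c g *: g) ->
        forall g, g \in in_degree B d -> c g = 0].
Proof.
by case=> uB _ _ /(_ d) /(basis_mod_lowerP _ _ (in_degree_uniq d uB)).
Qed.

Lemma standard_basis_ideal I B : standard_basis I B -> is_ideal I.
Proof. by case=> _ _ <- _; apply: is_ideal_gen. Qed.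

Lemma standard_basis_sub I B g : standard_basis I B -> g \in B -> I g.
Proof. by case=> _ _ <- _ gB; apply: ideal_gen_inc. Qed.

Lemma standard_basis_form I B g : standard_basis I B -> g \in B ->
  g \is (pdeg g).-homog.
Proof. by case=> _ Bf _ _ /Bf/form_homog. Qed.

(** Coefficients of members of degree [d] are scalars, and the members of
    smaller degree contribute to the lower part. *)
Lemma combination_mod_lower I B h d (r : S -> S) (P : pred S) :
  is_ideal I -> (forall g, g \in B -> I g /\ Defs.form g) -> h \is d.-homog ->
  h = \sum_(g <- [seq g <- B | P g]) r g * g ->
  exists c : S -> K,
    lower_part I d (h - \sum_(g <- in_degree B d | P g) c g *: g).
Proof.
move=> idI BI hh Eh.
have [|t [{Eh}Eh tH]] := homog_combination _ hh Eh.
  by move=> g; rewrite mem_filter => /andP[_ /BI[]].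
exists (fun g => if pdeg g == d then (t g)@_0 else 0).
rewrite /in_degree big_filter_cond {1}Eh big_filter.
rewrite [X in _ - X]big_mkcondl /= -sumrB; apply: lower_part_sum => g gB Pg.
have [Ig /form_homog hg] := BI g gB.
have [tle tgt] := tH g; case: (ltngtP (pdeg g) d) => [lt|lt|Ed].
- have -> : (if g \is d.-homog then 0 *: g else 0) = 0.
    by rewrite scale0r; case: ifP.
  by rewrite subr0 -[d](subnK (ltnW lt)); apply: lower_part_mul; rewrite ?subn_gt0 // tle // ltnW.
- have -> : (if g \is d.-homog then 0 *: g else 0) = 0.
    by rewrite scale0r; case: ifP.
  by rewrite tgt // mul0r subr0; apply: lower_part0.
- move: tle; rewrite Ed leqnn subnn => /(_ isT)/homog0E {1}->.
  by rewrite -Ed hg mul_mpolyC subrr; apply: lower_part0.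
Qed.

(** Modulo the lower part, such a combination would be a linear dependency
    between [f] and the other members of its degree. *)
Lemma standard_basis_minimal I B f : standard_basis I B -> f \in B ->
  ~ ideal_gen ([set` B] `\ f) f.
Proof.
move=> stB fB; have [uB Bf _ _] := stB; rewrite set_seqD1.
rewrite ideal_gen_seqP ?filter_uniq // => -[r Er].
have hf := standard_basis_form stB fB.
have [|c] := combination_mod_lower (standard_basis_ideal stB) _ hf Er.
  by move=> g gB; split; [apply: (standard_basis_sub stB) | apply: Bf].
have [_ _ ind] := standard_basisP (pdeg f) stB.
have fBd : f \in in_degree B (pdeg f) by rewrite mem_in_degree hf.
have -> : f - \sum_(g <- in_degree B (pdeg f) | g != f) c g *: g =
    \sum_(g <- in_degree B (pdeg f)) (if g == f then 1 else - c g) *: g.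
  rewrite [RHS](bigD1_seq f) ?in_degree_uniq //= eqxx scale1r -sumrN.
  by congr (_ + _); apply: eq_bigr => g /negbTE ->; rewrite scaleNr.
by move/ind/(_ _ fBd); rewrite eqxx => /eqP; rewrite oner_eq0.
Qed.

Lemma standard_basis_neq0 I B g : standard_basis I B -> g \in B -> g != 0.
Proof.
move=> stB gB; apply/eqP => g0; apply: (standard_basis_minimal stB gB).
by rewrite {2}g0; case: (is_ideal_gen ([set` B] `\ g)).
Qed.

Lemma mem_in_degreeE I B d g : standard_basis I B -> g \in B ->
  (g \is d.-homog) = (pdeg g == d).
Proof.
move=> stB gB; apply/idP/eqP => [/pdegE|<-]; last exact: standard_basis_form stB gB.
by apply; apply: standard_basis_neq0 stB gB.
Qed.

(** Two bases of one vector space: the matrices expressing each in terms of the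
    other are inverse to each other. *)
Lemma standard_basis_size_degree I B B' d :
  standard_basis I B -> standard_basis I B' ->
  size (in_degree B d) = size (in_degree B' d).
Proof.
move=> stB stB'; suff le B1 B2 : standard_basis I B1 -> standard_basis I B2 ->
    (size (in_degree B1 d) <= size (in_degree B2 d))%N.
  by apply/eqP; rewrite eqn_leq !le.
move=> {B B' stB stB'} [_ _ _ /(_ d)[sI1 gen1 ind1]] [_ _ _ /(_ d)[sI2 gen2 ind2]].
set s1 := in_degree B1 d in sI1 gen1 ind1 *; set s2 := in_degree B2 d in sI2 gen2 ind2 *.
have [i|M HM] := choice (_ : forall i : 'I_(size s1), exists c : 'I_(size s2) -> K,
    lower_part I d (s1`_i - \sum_(j < size s2) c j *: s2`_j)).
  by apply/gen2/sI1/mem_nth.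
have [j|N HN] := choice (_ : forall j : 'I_(size s2), exists c : 'I_(size s1) -> K,
    lower_part I d (s2`_j - \sum_(i < size s1) c i *: s1`_i)).
  by apply/gen1/sI2/mem_nth.
apply: (@mulmx1_min _ _ _ (\matrix_(i, j) M i j) (\matrix_(j, i) N j i)).
apply/matrixP => i k; rewrite !mxE; apply/eqP; rewrite -subr_eq0.
under eq_bigr do rewrite !mxE.
pose c (l : 'I_(size s1)) : K := \sum_j M i j * N j l - (i == l)%:R.
suff /ind1/(_ k) : lower_part I d (\sum_(l < size s1) c l *: s1`_l) by move/eqP.
have -> : \sum_(l < size s1) c l *: s1`_l = - (s1`_i - \sum_j M i j *: s2`_j)
    - \sum_j M i j *: (s2`_j - \sum_(l < size s1) N j l *: s1`_l).
  rewrite opprB; under [X in _ = _ - X]eq_bigr do rewrite scalerBr.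
  rewrite sumrB opprB [RHS]addrC addrA subrK.
  under eq_bigr do rewrite /c scalerBl.
  rewrite sumrB; congr (_ - _).
    under eq_bigr do rewrite scaler_suml.
    rewrite exchange_big; apply: eq_bigr => j _; rewrite scaler_sumr.
    by apply: eq_bigr => l _; rewrite scalerA.
  rewrite (bigD1 i) //= eqxx scale1r big1 ?addr0 // => l nl.
  by rewrite eq_sym (negbTE nl) scale0r.
apply: lower_partB; first exact: lower_partN.
by apply: lower_part_sum => j _ _; apply: lower_partZ.
Qed.

Lemma standard_basis_size I B B' :
  standard_basis I B -> standard_basis I B' -> size B = size B'.
Proof.
move=> stB stB'.
have [D BD] : exists D, forall g, (g \in B) || (g \in B') -> (pdeg g < D)%N.
  exists (\max_(g <- B ++ B') pdeg g).+1 => g; rewrite -mem_cat => gB.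
  by rewrite ltnS; apply: leq_bigmax_seq.
have sizeE B1 : standard_basis I B1 -> (forall g, g \in B1 -> (pdeg g < D)%N) ->
    size B1 = (\sum_(d < D) size (in_degree B1 d))%N.
  move=> stB1 lt; under eq_bigr do rewrite size_filter -sum1_count.
  rewrite (exchange_big_dep predT) //= -sum1_size big_seq [RHS]big_seq.
  apply: eq_bigr => g gB; under eq_bigl do rewrite (mem_in_degreeE _ stB1 gB).
  by rewrite (big_pred1 (Ordinal (lt g gB))) // => d; rewrite -val_eqE eq_sym.
rewrite (sizeE B) ?(sizeE B') //.
- by apply: eq_bigr => d _; apply: standard_basis_size_degree stB stB'.
- by move=> g gB; apply: BD; rewrite gB orbT.
- by move=> g gB; apply: BD; rewrite gB.
Qed.

Lemma is_alpha_unique I a b : is_alpha I a -> is_alpha I b -> a = b.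
Proof.
suff le a' b' : is_alpha I a' -> is_alpha I b' -> (b' <= a')%N.
  by move=> Ha Hb; apply/eqP; rewrite eqn_leq !le.
move=> [B1 [stB1 [f fB hf] _]] [B2 [stB2 _ minB2]].
have : (0 < size (in_degree B2 a'))%N.
  rewrite -(standard_basis_size_degree a' stB1 stB2).
  by rewrite -has_predT; apply/hasP; exists f; rewrite ?mem_in_degree ?hf.
case E: (in_degree B2 a') => [//|g s] _.
have : g \in in_degree B2 a' by rewrite E mem_head.
by rewrite mem_in_degree => /andP[hg gB]; apply: minB2 hg.
Qed.

(** Changing the basis in this way adds multiples of the coefficients of other
    members to the coefficient of [f] in every relation; it is how a strongly
    inessential member is tested against many bases.  Modulo the lower part it
    is an elementary operation on the members of the degree of [f]. *)
Lemma standard_basis_shear I B f (q : S -> S) : standard_basis I B -> f \in B ->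
  q f = 0 ->
  (forall g, g \in B -> q g = 0 \/
     (pdeg f <= pdeg g)%N /\ q g \is (pdeg g - pdeg f).-homog) ->
  standard_basis I [seq g + q g * f | g <- B].
Proof.
move=> stB fB qf qH; have [uB Bf EI _] := stB.
have idI := standard_basis_ideal stB; have hf := standard_basis_form stB fB.
pose tau g := g + q g * f; rewrite -/(map tau B).
have tauf : tau f = f by rewrite /tau qf mul0r addr0.
have htau g : g \in B -> tau g \is (pdeg g).-homog.
  move=> gB; apply: dhomogD; first exact: standard_basis_form stB gB.
  case: (qH g gB) => [->|[le hq]]; first by rewrite mul0r dhomog0.
  by rewrite -(subnK le) dhomogM.
have indep g h a : g \in B -> h \in B -> h != g -> g != f -> g <> h + a * f.
  move=> gB hB nhg ngf Eg; apply: (standard_basis_minimal stB gB).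
  rewrite [X in ideal_gen _ X]Eg.
  apply: (idealD (is_ideal_gen _)); last apply: (idealMl _ (is_ideal_gen _));
    apply: ideal_gen_inc; split=> //=; first by apply/eqP.
  by apply/eqP; rewrite eq_sym.
have tau_neq0 g : g \in B -> tau g != 0.
  move=> gB; apply/eqP => tg0; have [Eg|ngf] := eqVneq g f.
    by move: tg0; rewrite Eg tauf; apply/eqP; apply: standard_basis_neq0 stB fB.
  apply: (indep g f (- q g - 1)) => //; first by rewrite eq_sym.
  rewrite mulrBl mul1r addrC subrK mulNr.
  by apply/eqP; rewrite -addr_eq0; apply/eqP.
have tau_inj : {in B &, injective tau}.
  suff H g h : g \in B -> h \in B -> h != f -> tau g = tau h -> g = h.
    move=> g h gB hB E; have [hf'|] := eqVneq h f; last by move/H; apply.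
    have [gf|ngf] := eqVneq g f; first by rewrite gf hf'.
    by apply/esym; apply: (H h g) => //.
  move=> gB hB nhf E; apply: contrapT => /eqP ngh.
  apply: (indep h g (q g - q h)) => //.
  by rewrite mulrBl addrA -/(tau g) E /tau addrK.
have Ed d : in_degree (map tau B) d = map tau (in_degree B d).
  rewrite /in_degree filter_map; congr map; apply: eq_in_filter => g gB /=.
  rewrite (mem_in_degreeE d stB gB); apply/idP/eqP => [hd|<-]; last exact: htau.
  by rewrite -(pdegE (tau_neq0 g gB) hd) (pdegE (tau_neq0 g gB) (htau g gB)).
have ItauB g : g \in B -> I (tau g).
  move=> gB; apply: (idealD idI); first exact: standard_basis_sub stB gB.
  by apply: (idealMl _ idI); apply: standard_basis_sub stB fB.
split.
- by rewrite map_inj_in_uniq.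
- by move=> _ /mapP[g gB ->]; exists (pdeg g); apply: htau.
- apply/seteqP; split; first by apply: ideal_gen_min => // _ /mapP[g gB ->]; apply: ItauB.
  rewrite -EI; apply: ideal_gen_min; first exact: is_ideal_gen.
  move=> g /= gB; have -> : g = tau g - q g * tau f by rewrite tauf addrK.
  apply: (idealB (is_ideal_gen _)); last apply: (idealMl _ (is_ideal_gen _));
    apply: ideal_gen_inc; exact: map_f.
move=> d; rewrite Ed; apply/basis_mod_lowerP.
  rewrite map_inj_in_uniq ?in_degree_uniq // => g h.
  by rewrite !mem_in_degree => /andP[_ gB] /andP[_ hB]; apply: tau_inj.
have [sI gen ind] := standard_basisP d stB.
(* Modulo the lower part, [tau] adds a scalar multiple of [f], and only to
   members of the degree of [f]. *)
pose c g : K := if pdeg g == pdeg f then (q g)@_0 else 0.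
have cf : c f = 0 by rewrite /c eqxx qf mcoeff0.
have pdeg_d g : g \in in_degree B d -> pdeg g = d.
  by rewrite mem_in_degree => /andP[hg /(standard_basis_neq0 stB)/pdegE]; apply.
have tau_mod g : g \in in_degree B d -> lower_part I d (tau g - (g + c g *: f)).
  move=> gBd; have Eg := pdeg_d g gBd; have gB : g \in B.
    by move: gBd; rewrite mem_in_degree => /andP[].
  have l0 : c g *: f = q g * f -> lower_part I d (tau g - (g + c g *: f)).
    by move=> ->; rewrite subrr; apply: lower_part0.
  case: (qH g gB) => [q0|[]].
    by apply: l0; rewrite /c q0 mcoeff0 if_same mul0r scale0r.
  rewrite leq_eqVlt Eg => /predU1P[Ef|lt] hq.
    apply: l0; rewrite /c Eg Ef eqxx -mul_mpolyC; congr (_ * _).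
    by apply/esym/homog0E; move: hq; rewrite Ef subnn.
  rewrite /c Eg.
  rewrite gtn_eqF // scale0r addr0 /tau addrC addKr.
  rewrite -[d](subnK (ltnW lt)); apply: lower_part_mul => //.
    by rewrite subn_gt0.
  by split=> //; apply: standard_basis_sub stB fB.
pose C (b : S -> K) := \sum_(g <- in_degree B d) b g * c g.
have C0 b : f \notin in_degree B d -> C b = 0.
  rewrite mem_in_degree fB andbT (mem_in_degreeE d stB fB) => nfd.
  rewrite /C big_seq big1 // => g /pdeg_d Eg.
  by rewrite /c Eg eq_sym (negbTE nfd) mulr0.
have sum_mod (b : S -> K) : lower_part I d
    (\sum_(g <- in_degree B d) b g *: tau g -
     (\sum_(g <- in_degree B d) b g *: g + C b *: f)).
  rewrite /C scaler_suml -big_split -sumrB /=; apply: lower_part_sum => g gBd _.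
  by rewrite -scalerA -scalerDr -scalerBr; apply: lower_partZ; apply: tau_mod.
have sum_f (a : K) (b : S -> K) : (f \notin in_degree B d -> a = 0) ->
    \sum_(g <- in_degree B d) (b g + (g == f)%:R * a) *: g =
    \sum_(g <- in_degree B d) b g *: g + a *: f.
  move=> a0; under eq_bigr do rewrite scalerDl.
  rewrite big_split /=; congr (_ + _); have [fBd|/a0->] := boolP (f \in in_degree B d).
    rewrite (bigD1_seq f) ?in_degree_uniq //= eqxx mul1r big1 ?addr0 // => g /negbTE ->.
    by rewrite mul0r scale0r.
  by rewrite scale0r big1 // => g _; rewrite mulr0 scale0r.
have injd : {in in_degree B d &, injective tau}.
  by move=> g h; rewrite !mem_in_degree => /andP[_ gB] /andP[_ hB]; apply: tau_inj.
split=> [_ /mapP[g gBd ->]|h /gen[b Hb]|b].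
- rewrite -(pdeg_d g gBd); move: gBd; rewrite mem_in_degree => /andP[_ gB].
  by split; [apply: ItauB | apply: htau].
- pose b2 g := b g + (g == f)%:R * - C b.
  exists (fun u => b2 (nth 0 (in_degree B d) (index u (map tau (in_degree B d))))).
  rewrite big_map; under eq_big_seq => g gBd do rewrite nth_index_map //.
  have Eb2 : \sum_(g <- in_degree B d) b2 g *: g + C b2 *: f =
      \sum_(g <- in_degree B d) b g *: g.
    rewrite sum_f => [|/C0->]; last by rewrite oppr0.
    have -> : C b2 = C b.
      apply: eq_bigr => g _; rewrite /b2; case: eqP => [->|_].
        by rewrite cf !mulr0.
      by rewrite mul0r addr0.
    by rewrite scaleNr subrK.
  have := lower_partB Hb (sum_mod b2).
  by rewrite Eb2 opprB addrA subrK.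
- rewrite big_map => /lower_partB/(_ (sum_mod (b \o tau))); rewrite opprB addrC subrK.
  rewrite -sum_f; last exact: C0.
  move/ind => H _ /mapP[g gBd ->].
  have b0 h : h \in in_degree B d -> h != f -> b (tau h) = 0.
    by move=> hBd /negbTE nhf; have := H h hBd; rewrite /= nhf mul0r addr0.
  have [Eg|] := eqVneq g f; last exact: b0.
  have := H g gBd; rewrite /= Eg eqxx mul1r.
  rewrite /C big_seq big1 ?addr0 // => h hBd; have [->|nhf] := eqVneq h f.
    by rewrite cf mulr0.
  by rewrite /= b0 // mul0r.
Qed.

End StandardBases.

(** * The upper bound *)

(** Take a matrix of maximal rank among those with row space in [V]: adjoining a
    vector of [V] to its rows cannot increase the rank. *)
Lemma subspace_full_or_annihilated (K : fieldType) n (V : set 'rV[K]_n) :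
  V 0 -> (forall a u v, V u -> V v -> V (a *: u + v)) ->
  (exists A : 'M[K]_n, A \in unitmx /\ forall i, V (row i A)) \/
  (exists2 c : 'cV[K]_n, c != 0 & forall u, V u -> u *m c = 0).
Proof.
move=> V0 VP; pose inV (A : 'M[K]_n) := forall u : 'rV_n, (u <= A)%MS -> V u.
have exr : exists r, `[< exists2 A, inV A & \rank A = r >].
  exists 0%N; apply/asboolP; exists 0; last by rewrite mxrank0.
  by move=> u; rewrite submx0 => /eqP ->.
have bound r : `[< exists2 A, inV A & \rank A = r >] -> (r <= n)%N.
  by case/asboolP=> A _ <-; apply: rank_leq_row.
case: (ex_maxnP exr bound) => r /asboolP[A VA <-] maxr.
have [full|nfull] := boolP (row_full A).
  left; exists A; rewrite -row_full_unit full; split=> // i.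
  by apply: VA; apply: row_sub.
right; have VsubA u : V u -> (u <= A)%MS.
  move=> Vu; have : (\rank (A + u)%MS <= \rank A)%N.
    apply: maxr; apply/asboolP; exists (A + u)%MS => // w /sub_addsmxP[[a b] ->] /=.
    rewrite addrC (mx11_scalar b) mul_scalar_mx.
    by apply: VP => //; apply: VA; apply: submxMl.
  have sub : (A <= A + u)%MS by apply: addsmxSl.
  rewrite (geq_leqif (mxrank_leqif_sup sub)) => le.
  by apply: submx_trans le; apply: addsmxSr.
have nzk : cokermx A != 0.
  apply: contra nfull => /eqP k0; rewrite -sub1mx submxE k0 mulmx0.
  exact: eqxx.
have [i ni] : exists i, col i (cokermx A) != 0.
  apply: contrapT => H; case/eqP: nzk; apply/matrixP => i j; rewrite mxE.
  have : col j (cokermx A) == 0.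
    by apply/negPn/negP => nj; apply: H; exists j.
  by move/eqP/colP/(_ i); rewrite !mxE.
exists (col i (cokermx A)) => // u /VsubA; rewrite submxE => /eqP u0.
by rewrite colE mulmxA u0 mul0mx.
Qed.

Section UpperBound.

Variable (K : closedFieldType).
Local Notation S := (poly3 K).
Variables (I : set S) (B : seq S).
Hypothesis stB : standard_basis I B.

Definition relation_on (u : S -> S) := \sum_(g <- B) u g * g = 0.

(** Let [f] be a member of least degree in a linear dependency at the point [v]
    between the coefficients of relations.  Adding to the other members multiples
    of [f] by forms with prescribed values at [v] gives a basis for which the
    coefficient of [f] in every relation vanishes at [v]; then [f] cannot be
    inessential for this basis, as a power of a variable would vanish at [v]. *)
Lemma strongly_inessential_independent (v : 'I_3 -> K) (c : S -> K) :
  (exists i, v i != 0) ->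
  (forall g, c g != 0 -> g \in B /\ strongly_inessential I g) ->
  (forall u, relation_on u -> \sum_(g <- B) c g * (u g).@[v] = 0) ->
  forall g, c g = 0.
Proof.
move=> [i nzv] cT rel; apply: contrapT => /existsNP[g0 /eqP ng0].
(* Least degree makes the forms of degree [pdeg g - pdeg f] below available. *)
have [f nzc minf] : exists2 f, c f != 0
    & forall g, c g != 0 -> (pdeg f <= pdeg g)%N by apply: exists_minimal; exists g0.
have {g0 ng0} [fB [_ [_ _ inessf]]] := cT f nzc.
pose val g := - (c g / c f) / v i ^+ (pdeg g - pdeg f).
pose q g : S := if (g == f) || (c g == 0) then 0
  else val g *: 'X_i ^+ (pdeg g - pdeg f).
have qf : q f = 0 by rewrite /q eqxx.
have qv g : g != f -> (q g).@[v] = - (c g / c f).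
  rewrite /q => /negbTE ->; have [->|nc] /= := eqVneq (c g) 0.
    by rewrite meval0 mul0r oppr0.
  by rewrite mevalZ rmorphXn /= mevalXU divfK // expf_neq0.
have qH g : g \in B -> q g = 0 \/
    (pdeg f <= pdeg g)%N /\ q g \is (pdeg g - pdeg f).-homog.
  move=> gB; rewrite /q; case: ifP => [_|/norP[_ nc]]; [by left | right].
  split; first exact: minf.
  apply: dhomogZ; rewrite -{2}[(pdeg g - pdeg f)%N]mul1n; apply: dhomogMn.
  by rewrite dhomogX /= mdeg1.
have stB' := standard_basis_shear stB fB qf qH.
pose tau g := g + q g * f; rewrite -/(map tau B) in stB'.
have tauf : tau f = f by rewrite /tau qf mul0r addr0.
have [|t Ht] := inessf _ stB'; first by rewrite -{1}tauf map_f.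
have : ideal_gen ([set` map tau B] `\ f) (f * 'X_i ^+ t).
  apply: Ht; apply: ideal_gen_inc; exists (fun=> 'X_i).
  by rewrite prodr_const card_ord; split=> // _; apply: ideal_gen_inc; exists i.
rewrite set_seqD1 ideal_gen_seqP; last by rewrite filter_uniq //; case: stB'.
case=> r; rewrite filter_map big_map big_filter /preim /= => Er.
(* The relation for the new basis, rewritten as a relation for [B]. *)
pose s := \sum_(g <- B | tau g != f) r (tau g) * q g - 'X_i ^+ t.
pose u g := (if tau g != f then r (tau g) else 0) + (if g == f then s else 0).
have uB : uniq B by case: stB.
have sum_u (A : comNzRingType) (F : S -> A) (phi : {additive S -> A}) : 
    \sum_(g <- B) F g * phi (u g) =
    \sum_(g <- B | tau g != f) F g * phi (r (tau g)) + F f * phi s.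
  under eq_bigr => g _ do rewrite /u raddfD mulrDr.
  rewrite big_split /=; congr (_ + _).
    rewrite [RHS]big_mkcond; apply: eq_bigr => g _; case: ifP => // _.
    by rewrite raddf0 mulr0.
  rewrite (bigD1_seq f) //= eqxx big1 ?addr0 // => g /negbTE ->.
  by rewrite raddf0 mulr0.
have relu : relation_on u.
  rewrite /relation_on; under eq_bigr do rewrite mulrC.
  have := sum_u S id idfun; rewrite /= => ->.
  rewrite /s mulrBr Er mulr_sumr addrA -big_split /=; apply/eqP.
  rewrite subr_eq0; apply/eqP.
  by apply: eq_bigr => g _; rewrite /tau mulrDr [g * _]mulrC mulrCA [f * _]mulrC.
have := rel u relu; rewrite (sum_u K c (meval v)) /s raddfB raddf_sum /=.
rewrite mulrBr mulr_sumr addrA -big_split /= big1 => [|g tg].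
  rewrite sub0r rmorphXn /= mevalXU => /eqP; rewrite oppr_eq0 mulf_eq0 (negbTE nzc).
  by rewrite expf_eq0 (negbTE nzv) andbF.
rewrite mevalM qv; last by apply: contraNneq tg => ->; rewrite tauf.
by rewrite mulrCA mulrN mulrCA mulfV // mulr1 mulrN mulrC subrr.
Qed.

Let T := [seq g <- B | `[< strongly_inessential I g >]].
Let C := [seq g <- B | ~~ `[< strongly_inessential I g >]].

Let T_sub g : g \in T -> g \in B /\ strongly_inessential I g.
Proof. by rewrite mem_filter => /andP[/asboolP]. Qed.

Let split_sum (F : S -> S) :
  \sum_(g <- B) F g = \sum_(g <- T) F g + \sum_(g <- C) F g.
Proof.
by rewrite (bigID (fun g => `[< strongly_inessential I g >])) !big_filter.
Qed.

(** By independence some relations have an invertible matrix of coefficients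
    at [v]; its determinant carries the members of [T] into the ideal
    generated by the remaining ones (Cramer). *)
Lemma local_generation (v : 'I_3 -> K) : (exists i, v i != 0) ->
  exists2 D : S, (forall g, g \in T -> ideal_gen [set` C] (D * g)) & D.@[v] != 0.
Proof.
move=> nzv; have uT : uniq T by rewrite filter_uniq //; case: stB.
have idC := is_ideal_gen [set` C].
pose V : set 'rV[K]_(size T) :=
  [set w : 'rV_(size T) |
    exists2 u, relation_on u & forall j : 'I_(size T), w 0 j = (u T`_j).@[v]].
have [||[A [uA VA]]|[c nzc Vc]] := @subspace_full_or_annihilated K (size T) V.
- exists (fun=> 0) => [|j]; last by rewrite mxE meval0.
  by rewrite /relation_on big1 // => g _; rewrite mul0r.
- move=> a u w [u' ru Eu] [w' rw Ew]; exists (fun g => a%:MP * u' g + w' g).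
    rewrite /relation_on; under eq_bigr do rewrite mulrDl -mulrA.
    by rewrite big_split /= -mulr_sumr ru rw mulr0 addr0.
  by move=> j; rewrite !mxE Eu Ew mevalD mevalM mevalC.
- have /choice[u uH] : forall i : 'I_(size T), exists u, relation_on u /\
      forall j : 'I_(size T), A i j = (u T`_j).@[v].
    by move=> i; have [u ru Eu] := VA i; exists u; split=> // j; rewrite -Eu mxE.
  pose M : 'M[S]_(size T) := \matrix_(i, j < size T) u i T`_j.
  have MA : map_mx (meval v) M = A.
    by apply/matrixP => i j; rewrite !mxE; case: (uH i).
  exists (\det M); last first.
    by rewrite -det_map_mx MA -unitfE -unitmxE.
  have rowM i : ideal_gen [set` C] (\sum_j M i j * T`_j).
    have -> : \sum_j M i j * T`_j = \sum_(g <- T) u i g * g.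
      rewrite (big_nth 0) big_mkord; apply: eq_bigr => j _; by rewrite mxE.
    have [+ _] := uH i; rewrite /relation_on split_sum => /eqP.
    rewrite addr_eq0 => /eqP ->; apply: (idealN idC).
    by apply: (ideal_sum_seq idC) => g gC; apply: (idealMl _ idC); apply: ideal_gen_inc.
  move=> g gT; have lt : (index g T < size T)%N by rewrite index_mem.
  pose k := Ordinal lt; have -> : g = T`_k by rewrite /= nth_index.
  have -> : \det M * T`_k = \sum_i (\adj M) k i * (\sum_j M i j * T`_j).
    have E j : \sum_i (\adj M) k i * M i j = \det M *+ (k == j).
      by have /matrixP/(_ k j) := mul_adj_mx M; rewrite !mxE.
    under [RHS]eq_bigr do rewrite mulr_sumr.
    rewrite exchange_big (bigD1 k) //= [X in _ + X]big1 => [|j nj].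
      by rewrite addr0; under [RHS]eq_bigr do rewrite mulrA; rewrite -mulr_suml E eqxx.
    by under eq_bigr do rewrite mulrA; rewrite -mulr_suml E eq_sym (negbTE nj) mul0r.
  by apply: (@ideal_sum S _ _ _ _ _ idC) => i _; apply: (idealMl _ idC); apply: rowM.
- case/eqP: nzc; pose c' g := oapp (c^~ 0) 0 (insub (index g T)).
  have c'E (j : 'I_(size T)) : c' T`_j = c j 0.
    by rewrite /c' (index_uniq _ (ltn_ord j) uT) valK.
  have c'0 g : g \notin T -> c' g = 0.
    by move=> ngT; rewrite /c' insubF // index_mem (negbTE ngT).
  have H : forall g, c' g = 0.
    apply: (strongly_inessential_independent nzv) => [g nzc|u ru].
      by apply: T_sub; apply: contraNT nzc => /c'0 ->.
    have /matrixP/(_ 0 0) := Vc (\row_j (u T`_j).@[v]) (ex_intro2 _ _ u ru (fun j => mxE _ _ _ _)).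
    rewrite !mxE => E0; rewrite -[RHS]E0 (bigID (mem T)) /=.
    rewrite [X in _ + X]big1 => [|g /c'0->]; last by rewrite mul0r.
    rewrite addr0 -big_filter.
    have -> : [seq g <- B | g \in T] = T.
      by apply: eq_in_filter => g gB; rewrite mem_filter gB andbT.
    rewrite (big_nth 0) big_mkord; apply: eq_bigr => j _.
    by rewrite !mxE c'E mulrC.
  by apply/colP => j; rewrite mxE -c'E H.
Qed.

(** By [local_generation] and the Nullstellensatz, powers of the variables carry
    [T] into the ideal generated by [C].  If [C] has at most two members, this
    ideal is saturated and hence contains [T], which contradicts minimality. *)
Lemma strongly_inessential_bound :
  (num_strongly_inessential I B <= size B - 3)%N.
Proof.
have uB : uniq B by case: stB.
have ET : num_strongly_inessential I B = size T by rewrite size_filter.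
have EB : size B = (size T + size C)%N by rewrite !size_filter count_predC.
rewrite ET EB; have [C3|C3] := leqP 3 (size C).
  by rewrite -addnBA // leq_addr.
case E: T => [//|f s]; have fT : f \in T by rewrite E mem_head.
have [fB _] := T_sub fT; have idC := is_ideal_gen [set` C].
case: (standard_basis_minimal stB fB); have CB : [set` C] `<=` [set` B] `\ f.
  move=> g /= gC; split; first by move: gC; rewrite mem_filter => /andP[].
  by move=> gf; move: gC fT; rewrite gf !mem_filter => /andP[/negbTE->].
apply: (ideal_gen_mono CB).
have uC : uniq C by rewrite filter_uniq.
have C12 x : ideal_gen [set` C] x <-> exists a b, x = a * C`_0 + b * C`_1.
  have EC : \sum_(g <- C) 0 * g = 0 :> S by rewrite big1 // => g _; rewrite mul0r.
  rewrite ideal_gen_seqP //; split=> [[r ->]|[a [b ->]]].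
    exists (r C`_0), (r C`_1); move: C3; case: (C) => [|g [|h []]] //= _.
    - by rewrite big_nil !mulr0 addr0.
    - by rewrite big_seq1 mulr0 addr0.
    - by rewrite !big_cons big_nil addr0.
  exists (fun g => if g == C`_0 then a else b); move: C3 uC.
  case: (C) => [|g [|h []]] //= _; rewrite ?inE ?andbT => ngh.
  - by rewrite big_nil !mulr0 addr0.
  - by rewrite big_seq1 eqxx mulr0 addr0.
  - by rewrite !big_cons big_nil addr0 eqxx eq_sym (negbTE ngh).
apply/C12/saturated_two_generated => i.
pose Q : set S := [set D | forall g, g \in T -> ideal_gen [set` C] (D * g)].
have idQ : is_ideal Q.
  split=> [g _|D D' HD HD' g gT|a D HD g gT].
  - by rewrite mul0r; case: idC.
  - by rewrite mulrDl; apply: (idealD idC); [apply: HD | apply: HD'].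
  - by rewrite -mulrA; apply: (idealMl _ idC); apply: HD.
have [N /(_ f fT)/C12[u [v Ef]]] := projective_nullstellensatz idQ local_generation i.
by exists N, u, v.
Qed.

End UpperBound.

(** * The syzygies of the extremal example *)

Section ExampleSyzygies.

Variables (R : idomainType) (X Y Z : R).
Hypothesis nzX : X != 0.
Hypothesis regXY : forall k u w, u * Y ^+ k = X * w -> divides X u.

Fixpoint tail_minor2 j : R * R :=
  if j is i.+1 then let: (p, q) := tail_minor2 i in
    (q, Y ^+ 2 * q + X * Z ^+ 3 * p)
  else (0, 1).

(** The determinant of the [j] by [j] band matrix with [Y ^ 2] on the diagonal,
    [Z ^ 3] above it and [- X] below, by its three-term recurrence; the pair
    [tail_minor2 j] consists of its values at [j - 1] and [j]. *)
Definition tail_minor j := (tail_minor2 j).2.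

(** Up to sign, the minor without row [j] of the [a + 1] by [a] matrix whose
    columns are the syzygies of [syz_comb] below: the block under row [j] is
    triangular with [X] on the diagonal, and the block above it is the band
    matrix of [tail_minor j]. *)
Definition minor a j := X ^+ (a - j) * tail_minor j.

Definition shift (g : nat -> R) j := if j is i.+1 then g i else 0.

Lemma tail_minor0 : tail_minor 0 = 1. Proof. by []. Qed.

Lemma tail_minorS j :
  tail_minor j.+1 = Y ^+ 2 * tail_minor j + X * Z ^+ 3 * shift tail_minor j.
Proof.
rewrite /tail_minor /=; case: j => [|j] /=; first by [].
by case: (tail_minor2 j).
Qed.

Lemma tail_minor_modX j : exists c, tail_minor j = Y ^+ (2 * j) + X * c.
Proof.
elim: j => [|j [c Ec]].
  by exists 0; rewrite muln0 expr0 mulr0 addr0.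
exists (Y ^+ 2 * c + Z ^+ 3 * shift tail_minor j).
by rewrite tail_minorS Ec mulnS exprD; ring.
Qed.

Lemma tail_minor_divX j u w : u * tail_minor j = X * w -> divides X u.
Proof.
have [c ->] := tail_minor_modX j => E.
apply: (@regXY (2 * j)%N u (w - u * c)).
by rewrite mulrBr -E mulrDr [X * (u * c)]mulrCA addrK.
Qed.

Lemma minor_shift a j : (j <= a)%N -> (0 < j)%N ->
  X * minor a j = Y ^+ 2 * shift (minor a) j + Z ^+ 3 * shift (shift (minor a)) j.
Proof.
case: j => // j ja _; rewrite /minor tail_minorS /=.
have pow i : (i < a)%N -> X ^+ (a - i) = X * X ^+ (a - i.+1).
  by move=> lt; rewrite -exprS subnSK.
rewrite (pow j ja); case: j ja => [|j] ja /=; first by rewrite !mulr0; ring.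
by rewrite (pow j (ltnW ja)) (pow j.+1 ja); ring.
Qed.

Lemma sum_shift a (w g : nat -> R) : w a.+1 = 0 ->
  \sum_(j < a.+1) w j.+1 * g j = \sum_(j < a.+1) w j * shift g j.
Proof.
move=> w0; rewrite big_ord_recr /= w0 mul0r addr0 [RHS]big_ord_recl /= mulr0 add0r.
by apply: eq_bigr => j _; rewrite /bump /=.
Qed.

(** The coefficients of [\sum_j w j * sigma_j], where the syzygy [sigma_j] for
    [0 < j <= a] is [X * e_j - Y ^ 2 * e_(j - 1) - Z ^ 3 * e_(j - 2)]. *)
Definition syz_comb (w : nat -> R) j :=
  X * w j - Y ^+ 2 * w j.+1 - Z ^+ 3 * w j.+2.

Lemma syz_comb_linear b (u v : nat -> R) j :
  syz_comb (fun i => b * u i + v i) j = b * syz_comb u j + syz_comb v j.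
Proof. by rewrite /syz_comb; ring. Qed.

Definition syz_coef a (w : nat -> R) := w 0%N = 0 /\ forall j, (a < j)%N -> w j = 0.

Lemma syz_combE a w : syz_coef a w ->
  \sum_(j < a.+1) syz_comb w j * minor a j = 0.
Proof.
case=> w0 wa; rewrite /syz_comb.
under eq_bigr do rewrite !mulrBl.
rewrite !sumrB; under [X in _ - X - _]eq_bigr do rewrite -mulrA mulrCA.
under [X in _ - _ - X]eq_bigr do rewrite -mulrA mulrCA.
rewrite (sum_shift (fun j => Y ^+ 2 * minor a j)) ?wa //.
rewrite (@sum_shift a (fun j => w j.+1) (fun j => Z ^+ 3 * minor a j)) ?wa //.
rewrite (sum_shift (shift (fun j => Z ^+ 3 * minor a j))) ?wa //.
rewrite -!sumrB big1 // => j _; case: (posnP j) => [->|j0].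
  by rewrite w0 mulr0 !mul0r !subr0.
rewrite -mulrA mulrCA -!mulrBr minor_shift ?j0 // -1?ltnS //.
suff -> : shift (fun j => Y ^+ 2 * minor a j) j = Y ^+ 2 * shift (minor a) j.
  suff -> : shift (shift (fun j => Z ^+ 3 * minor a j)) j =
      Z ^+ 3 * shift (shift (minor a)) j by rewrite -addrA -opprD subrr mulr0.
  by case: (nat_of_ord j) => [|[|i]] //=; rewrite mulr0.
by case: (nat_of_ord j) j0.
Qed.

Lemma syz_comb_inj a w : syz_coef a w ->
  (forall j, (j <= a)%N -> syz_comb w j = 0) -> forall j, w j = 0.
Proof.
move=> [_ wa] sw j; suff H k : forall j, (a < j + k)%N -> w j = 0.
  by apply: (H a.+1); rewrite addnS ltnS leq_addl.
elim: k => [|k IH] i; first by rewrite addn0; apply: wa.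
move=> lt; have [le|] := leqP i a; last exact: wa.
have l1 : (a < i.+1 + k)%N by rewrite addSnnS.
have l2 : (a < i.+2 + k)%N by rewrite addSn leqW.
have := sw i le; rewrite /syz_comb (IH _ l1) (IH _ l2) !mulr0 !subr0.
by move/eqP; rewrite mulf_eq0 (negbTE nzX) => /eqP.
Qed.

(** By induction on [a]: modulo [X] only the last minor survives, so its
    coefficient is a multiple of [X] and can be removed by a syzygy; the other
    minors, divided by [X], are those for [a - 1]. *)
Lemma minor_syzygies a (u : nat -> R) :
  \sum_(j < a.+1) u j * minor a j = 0 ->
  exists w, syz_coef a w /\ forall j, (j <= a)%N -> u j = syz_comb w j.
Proof.
elim: a u => [|a IH] u.
  rewrite big_ord1 /minor mul1r mulr1 => u0; exists (fun=> 0); split=> // j.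
  by rewrite leqn0 => /eqP ->; rewrite /syz_comb !mulr0 !subr0.
have minorS j : (j <= a)%N -> minor a.+1 j = X * minor a j.
  by move=> ja; rewrite /minor subSn // exprS mulrA.
rewrite big_ord_recr /=; under eq_bigr => j _ do
  rewrite (minorS j) -1?ltnS // mulrCA.
have minor_top b : minor b b = tail_minor b by rewrite /minor subnn mul1r.
rewrite -mulr_sumr minor_top => E.
have [|t Et] := @tail_minor_divX a.+1 (u a.+1) (- \sum_(j < a.+1) u j * minor a j).
  by apply/eqP; rewrite mulrN -addr_eq0 addrC E.
have {}Et : u a.+1 = t * X by exact: Et.
pose u' j := u j + (j == a)%:R * (Y ^+ 2 * t) + (j.+1 == a)%:R * (Z ^+ 3 * t).
have [|w [[w0 wa] Ew]] := IH u'.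
  have -> : \sum_(j < a.+1) u' j * minor a j =
      \sum_(j < a.+1) u j * minor a j + t * tail_minor a.+1.
    under eq_bigr do rewrite !mulrDl; rewrite !big_split /= -addrA.
    congr (_ + _); rewrite tail_minorS mulrDr; congr (_ + _).
      rewrite big_ord_recr /= eqxx mul1r big1 ?add0r => [|j _].
        by rewrite minor_top mulrAC mulrC.
      by rewrite ltn_eqF // !mul0r.
    case: (a) => [|b]; first by rewrite big_ord1 /= !mul0r !mulr0.
    rewrite (bigD1 (Ordinal (ltnW (ltnSn b.+1)))) //= eqxx mul1r.
    rewrite big1 ?addr0 => [|j]; first by rewrite /minor subSnn expr1; ring.
    by rewrite -val_eqE /= eqSS => /negbTE ->; rewrite !mul0r.
  by apply: (mulfI nzX); rewrite mulr0 -[RHS]E Et mulrDr; congr (_ + _); ring.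
exists (fun j => w j + (j == a.+1)%:R * t); split.
  split=> [|j ja]; first by rewrite w0 mul0r addr0.
  by rewrite wa ?(ltnW ja) // gtn_eqF // mul0r addr0.
move=> j; rewrite leq_eqVlt ltnS => /predU1P[->|ja].
  have gt0 i : (a.+1 < i)%N -> (i == a.+1)%:R = 0 :> R by move=> ?; rewrite gtn_eqF.
  have l2 : (a < a.+2)%N by rewrite leqW.
  rewrite /syz_comb eqxx (gt0 _ (ltnSn _)) (gt0 _ (leqW (ltnSn _))).
  rewrite (wa _ (ltnSn a)) (wa _ l2).
  by rewrite (wa _ (leqW l2)) Et /=; ring.
have := Ew j ja; rewrite /u' /syz_comb !eqSS (ltn_eqF (_ : j < a.+1)%N) //=.
move: (j == a)%:R (j.+1 == a)%:R => b c Euj.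
have -> : u j = u j + b * (Y ^+ 2 * t) + c * (Z ^+ 3 * t) -
    c * (Z ^+ 3 * t) - b * (Y ^+ 2 * t) by ring.
by rewrite Euj; ring.
Qed.

End ExampleSyzygies.

(** * A standard basis of the example *)

Section Example.

Variable (K : fieldType).
Local Notation S := (poly3 K).

Definition var_x : 'I_3 := ord0.
Definition var_y : 'I_3 := ord_max.
Definition var_z : 'I_3 := lift ord0 ord0.

Local Notation X := ('X_var_x : S).
Local Notation Y := ('X_var_y : S).
Local Notation Z := ('X_var_z : S).

Lemma ord3P (P : 'I_3 -> Prop) : P var_x -> P var_y -> P var_z -> forall i, P i.
Proof.
move=> Px Py Pz i; have [|[|]] : i = var_x \/ i = var_y \/ i = var_z.
- case: i => -[|[|[|//]]] lt; [left | right; right | right; left]; exact: val_inj.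
- by move=> ->.
- by move=> ->.
- by move=> ->.
Qed.

Lemma var_regXY k (u w : S) : u * Y ^+ k = X * w -> divides X u.
Proof.
move=> E; apply/zero_var_eq0; apply: (mulIf (expf_neq0 k (mpolyX_neq0 K var_y))).
have := congr1 (zero_var var_x) E; rewrite !zero_varM rmorphXn /= !zero_varX /=.
by rewrite !mul0r.
Qed.

Definition ex_form a j : S := minor X Y Z a j.
Definition ex_basis a : seq S := [seq ex_form a j | j <- iota 0 a.+1].
Definition ex_ideal a : set S := ideal_gen [set` ex_basis a].

Lemma homog_var i k : ('X_i : S) ^+ k \is k.-homog.
Proof.
by rewrite -{2}[k]mul1n; apply: dhomogMn; rewrite dhomogX /= mdeg1.
Qed.

Lemma tail_minor_homog j : tail_minor X Y Z j \is (2 * j).-homog.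
Proof.
suff: tail_minor X Y Z j \is (2 * j).-homog /\
    X * Z ^+ 3 * shift (tail_minor X Y Z) j \is (2 * j.+1).-homog by case.
elim: j => [|j [IH1 IH2]].
  by rewrite tail_minor0 mulr0 dhomog1 dhomog0.
split; first by rewrite tail_minorS dhomogD // mulnS dhomogM // homog_var.
have -> : (2 * j.+2 = 4 + 2 * j)%N by rewrite !mulnS addnA.
by rewrite dhomogM // -[4%N]/(1 + 3)%N dhomogM ?homog_var // -[X]expr1 homog_var.
Qed.

Lemma ex_form_homog a j : (j <= a)%N -> ex_form a j \is (a + j).-homog.
Proof.
move=> ja; have -> : (a + j = a - j + 2 * j)%N.
  by rewrite mul2n -addnn addnA subnK.
by rewrite dhomogM ?homog_var ?tail_minor_homog.
Qed.

Lemma zero_x_tail_minor j : zero_var var_x (tail_minor X Y Z j) = Y ^+ (2 * j).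
Proof.
have [c ->] := tail_minor_modX X Y Z j.
by rewrite zero_varD zero_varM rmorphXn /= !zero_varX /= mul0r addr0.
Qed.

Lemma ex_form_neq0 a j : ex_form a j != 0.
Proof.
rewrite mulf_neq0 ?expf_neq0 ?mpolyX_neq0 //; apply/eqP => t0.
have := zero_x_tail_minor j; rewrite t0 zero_var0 => /esym/eqP.
by rewrite (negbTE (expf_neq0 _ (mpolyX_neq0 K var_y))).
Qed.

Lemma pdeg_ex_form a j : (j <= a)%N -> pdeg (ex_form a j) = (a + j)%N.
Proof. by move=> ja; apply: pdegE (ex_form_neq0 a j) (ex_form_homog ja). Qed.

Lemma mem_ex_basis a g :
  reflect (exists2 j, (j <= a)%N & g = ex_form a j) (g \in ex_basis a).
Proof.
apply: (iffP mapP) => -[j ja ->]; exists j => //; first by move: ja; rewrite mem_iota.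
by rewrite mem_iota.
Qed.

Lemma ex_basis_uniq a : uniq (ex_basis a).
Proof.
rewrite map_inj_in_uniq ?iota_uniq // => i j; rewrite !mem_iota !add0n !ltnS /=.
by move=> ia ja /(congr1 (@pdeg K)); rewrite !pdeg_ex_form // => /addnI.
Qed.

Lemma big_ex_basis a (F : S -> S) :
  \sum_(g <- ex_basis a) F g = \sum_(j < a.+1) F (ex_form a j).
Proof. by rewrite big_map -[iota 0 a.+1]/(index_iota 0 a.+1) big_mkord. Qed.

Lemma ex_idealP a x :
  ex_ideal a x <-> exists u : nat -> S, x = \sum_(j < a.+1) u j * ex_form a j.
Proof.
rewrite /ex_ideal ideal_gen_seqP ?ex_basis_uniq //; split=> -[u ->].
  by exists (fun j => u (ex_form a j)); rewrite big_ex_basis.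
exists (fun g => u (pdeg g - a)%N); rewrite big_ex_basis.
by apply: eq_bigr => j _; rewrite pdeg_ex_form ?addKn // -ltnS.
Qed.

Lemma ex_ideal_homog a x d : ex_ideal a x -> x \is d.-homog ->
  exists u : nat -> S, x = \sum_(j < a.+1) u j * ex_form a j /\
    forall j, ((a + j <= d)%N -> u j \is (d - (a + j)).-homog) /\
              ((d < a + j)%N -> u j = 0).
Proof.
move=> /ideal_gen_seqP; rewrite ex_basis_uniq => /(_ isT) [r Er] hx.
have [g /mem_ex_basis[j ja ->]|t [{}Er tH]] := homog_combination _ hx Er.
  by exists (a + j)%N; apply: ex_form_homog.
exists (fun j => if (j <= a)%N then t (ex_form a j) else 0).
split=> [|j].
  by rewrite Er big_ex_basis; apply: eq_bigr => j _; rewrite -ltnS ltn_ord.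
case: (leqP j a) => ja; last by split=> // _; apply: rpred0.
by have := tH (ex_form a j); rewrite pdeg_ex_form.
Qed.

(** The entries [X], [Y ^ 2] and [Z ^ 3] of the syzygies vanish at the origin:
    no member is redundant. *)
Lemma ex_relation_coef0 a (u : nat -> S) :
  \sum_(j < a.+1) u j * ex_form a j = 0 ->
  forall j, (j <= a)%N -> (u j).@[fun=> 0] = 0.
Proof.
case/(minor_syzygies (mpolyX_neq0 K var_x) var_regXY) => w [_ Ew] j ja.
rewrite (Ew j ja) /syz_comb !mevalB !mevalM !mevalXU.
by rewrite !mul0r !subr0.
Qed.

Lemma ex_minimal a j (u : nat -> S) (c : K) : (j <= a)%N ->
  c *: ex_form a j = \sum_(i < a.+1) u i * ex_form a i ->
  u j = 0 -> c = 0.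
Proof.
move=> ja E uj.
have := @ex_relation_coef0 a (fun i => u i - (i == j)%:R * c%:MP) _ j ja.
rewrite uj eqxx mul1r sub0r mevalN mevalC => H; apply/eqP; rewrite -oppr_eq0.
apply/eqP; apply: H; under eq_bigr do rewrite mulrBl.
rewrite sumrB -E (bigD1 (Ordinal (ja : j < a.+1)%N)) //= eqxx mul1r big1 => [|i].
  by rewrite addr0 mul_mpolyC subrr.
by rewrite -val_eqE /= => /negbTE ->; rewrite !mul0r.
Qed.

Lemma is_ideal_ex a : is_ideal (ex_ideal a).
Proof. exact: is_ideal_gen. Qed.

Lemma ex_form_in a j : (j <= a)%N -> ex_ideal a (ex_form a j).
Proof. by move=> ja; apply: ideal_gen_inc; apply/mem_ex_basis; exists j. Qed.

Lemma ex_gen_low a d x :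
  ideal_gen (component (ex_ideal a) d) x ->
  exists u : nat -> S, x = \sum_(j < a.+1) u j * ex_form a j /\
    forall j, (d < a + j)%N -> u j = 0.
Proof.
move: x; apply: ideal_gen_min; last first.
  move=> x [Ix hx]; have [u [Eu uH]] := ex_ideal_homog Ix hx.
  by exists u; split=> // j; case: (uH j).
split.
- by exists (fun=> 0); split=> //; rewrite big1 // => j _; rewrite mul0r.
- move=> x y [u [-> u0]] [v [-> v0]]; exists (fun j => u j + v j); split.
    by rewrite -big_split; apply: eq_bigr => j _; rewrite mulrDl.
  by move=> j lt; rewrite u0 // v0 // addr0.
- move=> b x [u [-> u0]]; exists (fun j => b * u j); split.
    by rewrite mulr_sumr; apply: eq_bigr => j _; rewrite mulrA.
  by move=> j lt; rewrite u0 // mulr0.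
Qed.

Lemma ex_lower_low a d x : lower_part (ex_ideal a) d x ->
  exists u : nat -> S, x = \sum_(j < a.+1) u j * ex_form a j /\
    forall j, (d <= a + j)%N -> u j = 0.
Proof.
case: d => [->|d [n [g [l [Hg Hl ->]]]]].
  by exists (fun=> 0); split=> //; rewrite big1 // => j _; rewrite mul0r.
apply: ex_gen_low; apply: (@ideal_sum S _ _ _ _ _ (is_ideal_gen _)) => i _.
by apply: (idealMr _ (is_ideal_gen _)); apply: ideal_gen_inc.
Qed.

Lemma ex_standard a : standard_basis (ex_ideal a) (ex_basis a).
Proof.
split=> [|g /mem_ex_basis[j ja ->]||d]; first exact: ex_basis_uniq.
- by exists (a + j)%N; apply: ex_form_homog.
- by [].
apply/basis_mod_lowerP; first exact/in_degree_uniq/ex_basis_uniq.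
split=> [g|x [Ix hx]|c].
- rewrite mem_in_degree => /andP[hg gB]; split=> //; exact: ideal_gen_inc.
- have := Ix; rewrite /ex_ideal ideal_gen_seqP ?ex_basis_uniq // => -[r Er].
  have [||||c Hc] := @combination_mod_lower K (ex_ideal a) (ex_basis a) x d r predT.
  + exact: is_ideal_ex.
  + move=> g /mem_ex_basis[j ja ->]; split; first exact: ex_form_in.
    by exists (a + j)%N; apply: ex_form_homog.
  + exact: hx.
  + by rewrite big_filter.
  + by exists c.
- move=> /ex_lower_low[u [Eu u0]] g; rewrite mem_in_degree => /andP[hg].
  move=> /mem_ex_basis[j ja Eg]; have Ed : d = (a + j)%N.
    by rewrite -(pdeg_ex_form ja) -Eg (pdegE _ hg) // Eg ex_form_neq0.
  apply: (@ex_minimal a j u _ ja); last by apply: u0; rewrite Ed.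
  have gBd : g \in in_degree (ex_basis a) d.
    by rewrite mem_in_degree hg; apply/mem_ex_basis; exists j.
  rewrite -Eu -Eg (bigD1_seq g) ?in_degree_uniq ?ex_basis_uniq //.
  rewrite big_seq_cond big1 ?Monoid.mulm1 // => h /andP[]. rewrite mem_in_degree => /andP[hh].
  move=> /mem_ex_basis[i ia Eh] /eqP []; rewrite Eh Eg; congr ex_form.
  apply: (@addnI a); rewrite -Ed -(pdeg_ex_form ia) -Eh (pdegE _ hh) //.
  by rewrite Eh ex_form_neq0.
Qed.

Lemma size_ex_basis a : size (ex_basis a) = a.+1.
Proof. by rewrite size_map size_iota. Qed.

Lemma ex_alpha a : is_alpha (ex_ideal a) a.
Proof.
exists (ex_basis a); split; first exact: ex_standard.
  exists (ex_form a 0); first by apply/mem_ex_basis; exists 0%N.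
  by have := ex_form_homog (leq0n a); rewrite addn0.
move=> g d /mem_ex_basis[j ja ->] hg.
have := dhomog_uniq (ex_form_neq0 a j) hg (ex_form_homog ja) => ->.
exact: leq_addr.
Qed.

Lemma ex_homogeneous a : homogeneous_ideal (ex_ideal a).
Proof.
split; first exact: is_ideal_ex.
apply/seteqP; split.
  apply: ideal_gen_mono => g gB; split; first exact: ideal_gen_inc.
  by have /mem_ex_basis[j ja ->] := gB; exists (a + j)%N; apply: ex_form_homog.
by apply: ideal_gen_min => [|g []]; first exact: is_ideal_ex.
Qed.

End Example.

(** * Essential and inessential members of the example *)

Lemma is_ideal_colon (R : comNzRingType) (Q : set R) x :
  is_ideal Q -> is_ideal [set y | Q (x * y)].
Proof.
move=> idQ; split=> [/=|u v /= Qu Qv|a u /= Qu].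
- by rewrite mulr0; case: idQ.
- by rewrite mulrDr; apply: idealD.
- by rewrite mulrCA; apply: idealMl.
Qed.

(** Induction on the sum of the exponents: passing to the colon ideal of a
    variable lowers one exponent and removes one factor of the product. *)
Lemma irrelevant_pow_sub (K : fieldType) (Q : set (poly3 K)) (N : 'I_3 -> nat) :
  is_ideal Q -> (forall i, Q ('X_i ^+ N i)) ->
  ideal_pow irrelevant_ideal (\sum_i N i)%N `<=` Q.
Proof.
move=> idQ QN; apply: ideal_gen_min => // _ [g [Hg ->]].
move Ek: (\sum_i N i)%N => k in g Hg *.
elim: k Q idQ N QN Ek g Hg => [|k IH] Q idQ N QN Ek g Hg.
  rewrite big_ord0; have : (\sum_i N i == 0)%N by rewrite Ek.
  by rewrite sum_nat_eq0 => /forallP/(_ ord0)/eqP N0; have := QN ord0; rewrite N0.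
rewrite big_ord_recl; set m := \prod_(i < k) _.
have idQ' := is_ideal_colon m idQ; rewrite mulrC.
suff : irrelevant_ideal `<=` [set y | Q (m * y)] by apply; apply: Hg.
apply: ideal_gen_min => // _ [i ->] /=.
have [N0|Npos] := posnP (N i).
  apply: (idealMl _ idQ); have := QN i.
  by rewrite N0 expr0 => /(idealMr 'X_i idQ); rewrite mul1r.
rewrite mulrC; apply: (IH [set y | Q ('X_i * y)] _ (fun j => if j == i then (N j).-1 else N j)).
- exact: is_ideal_colon.
- move=> j /=; case: eqP => [->|_]; last exact: idealMl.
  by rewrite -exprS prednK.
- apply: succn_inj; rewrite -Ek (bigD1 i) //= [in RHS](bigD1 i) //= eqxx.
  rewrite -[in RHS](prednK Npos) addSn; congr (_ + _).+1.
  by apply: eq_bigr => j /negbTE ->.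
- by move=> j; apply: Hg.
Qed.

(** If the next two forms are multiples of [f0] modulo [E], the three
    consecutive syzygies through [f0] annihilate it by [X], [Y ^ 2], [Z ^ 3]. *)
Lemma band_annihilator (R : comNzRingType) (E : set R) (X Y Z p q f0 f1 f2 : R) :
  is_ideal E -> E p -> E q ->
  X * f0 = Y ^+ 2 * p + Z ^+ 3 * q ->
  X * f1 = Y ^+ 2 * f0 + Z ^+ 3 * p ->
  X * f2 = Y ^+ 2 * f1 + Z ^+ 3 * f0 ->
  (exists e r, E e /\ f1 = e + r * f0) ->
  (exists e r, E e /\ f2 = e + r * f0) ->
  [/\ E (X * f0), E (Y ^+ 2 * f0) & E (Z ^+ 3 * f0)].
Proof.
move=> idE Ep Eq E0 E1 E2 [e1 [r1 [Ee1 F1]]] [e2 [r2 [Ee2 F2]]].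
have EX : E (X * f0) by rewrite E0; apply: (idealD idE); apply: (idealMl _ idE).
have EY : E (Y ^+ 2 * f0).
  have -> : Y ^+ 2 * f0 = X * e1 + r1 * (X * f0) - Z ^+ 3 * p.
    by rewrite -(addrK (Z ^+ 3 * p) (Y ^+ 2 * f0)) -E1 F1; ring.
  by apply: (idealB idE); [apply: (idealD idE)|]; apply: (idealMl _ idE).
split=> //; have -> : Z ^+ 3 * f0 =
    X * e2 + r2 * (X * f0) - (Y ^+ 2 * e1 + r1 * (Y ^+ 2 * f0)).
  by rewrite -(addKr (Y ^+ 2 * f1) (Z ^+ 3 * f0)) -E2 F2 F1; ring.
by apply: (idealB idE); apply: (idealD idE); apply: (idealMl _ idE).
Qed.

Section ExampleEssential.

Variable (K : fieldType) (a : nat).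
Local Notation S := (poly3 K).
Local Notation X := ('X_var_x : S).
Local Notation Y := ('X_var_y : S).
Local Notation Z := ('X_var_z : S).
Local Notation I := (@ex_ideal K a).
Local Notation f_ := (ex_form K a).

Lemma ex_form_relation j : (j <= a)%N -> (0 < j)%N ->
  X * f_ j = Y ^+ 2 * f_ j.-1 + Z ^+ 3 * shift (shift f_) j.
Proof. by case: j => // j ja _; rewrite -[f_]/(minor X Y Z a) minor_shift. Qed.

(** The member [f] is a nonzero multiple of [f_ i] modulo [f_ 0, ...,
    f_ (i - 1)], which for degree reasons are combinations of the other members.
    Hence modulo the others [f_ i] generates the whole ideal, and
    [band_annihilator] applies to [f_ i], [f_ (i + 1)] and [f_ (i + 2)]. *)
Lemma ex_inessential B f i : standard_basis I B -> f \in B ->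
  f \is (a + i).-homog -> (0 < i)%N -> (i + 2 <= a)%N -> inessential B f.
Proof.
move=> stB fB hf i0 ia; have [uB Bf EI _] := stB.
pose E := ideal_gen ([set` B] `\ f); have idE : is_ideal E := is_ideal_gen _.
have BE g : g \in B -> g != f -> E g.
  by move=> gB /eqP ngf; apply: ideal_gen_inc.
have IB x : I x -> exists r : S -> S, x = \sum_(g <- B) r g * g.
  by rewrite -EI ideal_gen_seqP.
have pf : pdeg f = (a + i)%N by apply: pdegE hf; apply: standard_basis_neq0 stB fB.
have lowE k : (k < i)%N -> E (f_ k).
  move=> ki; have ka : (k <= a)%N.
    by rewrite (leq_trans _ ia) // (leq_trans (ltnW ki)) ?leq_addr.
  have [r Er] := IB _ (@ex_form_in K a _ ka).
  have [t [-> tH]] := homog_combination Bf (ex_form_homog K ka) Er.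
  apply: (ideal_sum_seq idE) => g gB; have [->|ngf] := eqVneq g f.
    have [_ ->] := tH f; first by rewrite mul0r; case: idE.
    by rewrite pf ltn_add2l.
  by apply: (idealMl _ idE); apply: BE.
have ia' : (i < a.+1)%N by rewrite ltnS (leq_trans _ ia) ?leq_addr.
have [c [e [Ee Ef]]] : exists (c : K) e, E e /\ f = c *: f_ i + e.
  have [u [Eu uH]] := ex_ideal_homog (standard_basis_sub stB fB) hf.
  exists (u i)@_0, (\sum_(j < a.+1 | j != Ordinal ia') u j * f_ j); split; last first.
    rewrite Eu (bigD1 (Ordinal ia')) //= -mul_mpolyC -homog0E //.
    by have [/(_ (leqnn _))] := uH i; rewrite subnn.
  apply: (@ideal_sum S _ _ _ _ _ idE) => j; rewrite -val_eqE /= => nji.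
  move: nji; rewrite neq_ltn => /orP[lt|gt].
    by apply: (idealMl _ idE); apply: lowE.
  by have [_ ->] := uH j; rewrite ?mul0r ?ltn_add2l //; case: idE.
have nzc : c != 0.
  apply/eqP => c0; apply: (standard_basis_minimal stB fB).
  by rewrite [X in ideal_gen _ X]Ef c0 scale0r add0r.
have modE x : I x -> exists e r, E e /\ x = e + r * f_ i.
  move=> /IB[r ->]; rewrite (bigD1_seq f) //=.
  exists (\sum_(g <- B | g != f) r g * g + r f * e), (r f * c%:MP); split.
    apply: (idealD idE); last exact: (idealMl _ idE).
    rewrite -big_filter; apply: (ideal_sum_seq idE) => g.
    by rewrite mem_filter => /andP[ngf gB]; apply: (idealMl _ idE); apply: BE.
  by rewrite {2}Ef mulrDr addrC -addrA [r f * e + _]addrC -mulrA mul_mpolyC.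
have i1 : (i.+1 <= a)%N by rewrite (leq_trans _ ia) // addn2 leqW.
have i2 : (i.+2 <= a)%N by rewrite -addn2.
have Eshift : E (shift (shift f_) i).
  case: (i) i0 lowE => [|[|k]] //= _ lowE; first by case: idE.
  exact: lowE.
have [||EX EY EZ] := band_annihilator idE (lowE i.-1 _) Eshift
  (ex_form_relation (ltnW i1) i0) (_ : X * f_ i.+1 = Y ^+ 2 * f_ i + Z ^+ 3 * f_ i.-1)
  (ex_form_relation i2 (ltn0Sn _)) (modE _ (@ex_form_in K a _ i1)) (modE _ (@ex_form_in K a _ i2)).
- by rewrite prednK.
- by rewrite ex_form_relation //; case: (i) i0.
have fE k m : E (m * f_ i) -> E (f * (m * k)).
  move=> Em; rewrite mulrA; apply: (idealMr _ idE); rewrite mulrC Ef mulrDr.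
  apply: (idealD idE); last exact: (idealMl _ idE).
  by rewrite -scalerAr -mul_mpolyC; apply: (idealMl _ idE).
exists (\sum_(i < 3) 3)%N => m.
apply: (irrelevant_pow_sub (is_ideal_colon f idE)); apply: ord3P => /=.
- by rewrite exprS; apply: fE.
- by rewrite exprSr; apply: fE.
- by rewrite -[_ ^+ 3]mulr1; apply: fE.
Qed.

Lemma ex_relation_eval (u : nat -> S) (v : 'I_3 -> K) j : v var_y = 0 ->
  \sum_(i < a.+1) u i * f_ i = 0 -> (j <= a)%N ->
  (j == 0)%N && (v var_z == 0) || (a < j + 2)%N && (v var_x == 0) ->
  (u j).@[v] = 0.
Proof.
move=> vy; case/(minor_syzygies (mpolyX_neq0 K var_x) (@var_regXY K)).
move=> w [[w0 wa] Ew] ja; rewrite (Ew j ja) /syz_comb !mevalB !mevalM !mevalXU vy.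
case/orP => /andP[+ /eqP->]; first by move=> /eqP->; rewrite w0 meval0 !(mul0r, mulr0) !subr0.
by rewrite addn2 => /wa ->; rewrite meval0 !(mul0r, mulr0) !subr0.
Qed.

(** The coefficients of [f_ j] in relations vanish at a point of the projective
    plane: at [(1 : 0 : 0)] for [j = 0], where [X] does not occur, and at
    [(0 : 0 : 1)] for the last two [j], where [Z ^ 3] does not occur. *)
Lemma ex_essential j : (j <= a)%N -> (j == 0)%N || (a < j + 2)%N ->
  essential (ex_basis K a) (f_ j).
Proof.
move=> ja Hj; have [i [niy Hi]] : exists i, i != var_y /\
    ((j == 0)%N && (i != var_z) || (a < j + 2)%N && (i != var_x)).
  by case/orP: Hj => ->; [exists var_x | exists var_z; rewrite orbT].
move=> [t Ht]; have : ideal_gen ([set` ex_basis K a] `\ f_ j) (f_ j * 'X_i ^+ t).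
  apply: Ht; apply: ideal_gen_inc; exists (fun=> 'X_i).
  by rewrite prodr_const card_ord; split=> // _; apply: ideal_gen_inc; exists i.
rewrite set_seqD1 ideal_gen_seqP ?filter_uniq ?ex_basis_uniq // => -[r Er].
pose v k : K := (k == i)%:R.
pose u k := (if k == j then - 'X_i ^+ t else r (f_ k)).
have f_inj (k : 'I_a.+1) : (f_ k == f_ j) = (k == j :> nat).
  apply/eqP/eqP => [/(congr1 (@pdeg K))|-> //].
  by rewrite !pdeg_ex_form -1?ltnS // => /addnI.
have : (u j).@[v] = 0.
  apply: (ex_relation_eval _ _ ja).
  - by rewrite /v eq_sym (negbTE niy).
  - rewrite (bigD1 (Ordinal (ja : j < a.+1)%N)) //= /u eqxx mulNr mulrC Er.
    have -> : \sum_(g <- [seq g <- ex_basis K a | g != f_ j]) r g * g =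
        \sum_(k < a.+1 | k != Ordinal (ja : j < a.+1)%N) r (f_ k) * f_ k.
      rewrite big_filter big_mkcond big_ex_basis [RHS]big_mkcond.
      by apply: eq_bigr => k _; rewrite f_inj -val_eqE.
    apply/eqP; rewrite addrC subr_eq0; apply/eqP; apply: eq_bigr => k.
    by rewrite -val_eqE /= => /negbTE ->.
  - have v0 k : i != k -> v k = 0 by rewrite /v eq_sym => /negbTE ->.
    by case/orP: Hi => /andP[-> /v0->]; rewrite eqxx ?orbT.
rewrite /u eqxx mevalN rmorphXn /= mevalXU /v eqxx expr1n => /eqP.
by rewrite oppr_eq0 oner_eq0.
Qed.

(** Each degree contains at most one member of any basis, and that of
    [ex_basis] is essential except in the degrees of [ex_inessential]. *)
Lemma ex_e_maximal : e_maximal I (ex_basis K a).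
Proof.
have stB := ex_standard K a; split=> // d; split; first by exists (ex_basis K a).
move=> B stB'.
have [[i [Ed i0 ia]]|nd] :=
  pselect (exists i, [/\ d = (a + i)%N, (0 < i)%N & (i + 2 <= a)%N]).
  rewrite /num_essential.
  have -> : count (fun f => `[< essential B f >]) (in_degree B d) = 0%N.
    apply/eqP; rewrite -leqn0 leqNgt -has_count; apply/hasPn => f.
    rewrite mem_in_degree Ed => /andP[hf fB]; apply/asboolPn => /(_ _).
    by apply; apply: ex_inessential stB' fB hf i0 ia.
  by [].
apply: (leq_trans (count_size _ _)).
rewrite -(standard_basis_size_degree d stB stB') /num_essential.
suff : all (fun f => `[< essential (ex_basis K a) f >]) (in_degree (ex_basis K a) d).
  by rewrite all_count => /eqP ->.
apply/allP => g; rewrite mem_in_degree => /andP[hg /mem_ex_basis[j ja Eg]].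
apply/asboolP; rewrite Eg; apply: ex_essential => //.
have Ed : d = (a + j)%N by rewrite -(pdeg_ex_form K ja) -Eg (pdegE _ hg) // Eg ex_form_neq0.
case: posnP => //= j0; rewrite ltnNge; apply/negP => j2; apply: nd.
by exists j.
Qed.

Lemma ex_strongly_inessential j : (0 < j)%N -> (j + 2 <= a)%N ->
  strongly_inessential I (f_ j).
Proof.
move=> j0 j2; have ja : (j <= a)%N by rewrite (leq_trans _ j2) ?leq_addr.
exists (a + j.-1).+1; have Ed : (a + j.-1).+1 = (a + j)%N by rewrite -addnS prednK.
split.
- by rewrite Ed; split; [apply: ex_form_in | apply: ex_form_homog].
- move=> /ex_gen_low[u [Eu u0]].
  have /eqP : (1 : K) = 0; last by rewrite oner_eq0.
  apply: (ex_minimal ja); first by rewrite scale1r; apply: Eu.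
  by apply: u0; rewrite ltn_add2l prednK.
- by move=> B stB fB; apply: ex_inessential stB fB (ex_form_homog K ja) j0 j2.
Qed.

Lemma ex_num_strongly_inessential :
  (a - 2 <= num_strongly_inessential I (ex_basis K a))%N.
Proof.
have [a2|a2] := leqP a 2; first by move: a2; rewrite -subn_eq0 => /eqP ->.
have Ei : iota 0 a.+1 = iota 0 1 ++ iota 1 (a - 2) ++ iota (1 + (a - 2)) 2.
  by rewrite -!iotaD; congr iota; rewrite -subSS addSn add0n -addnS subnK // ltnW.
rewrite /num_strongly_inessential count_map Ei !count_cat addnCA.
apply: leq_trans (leq_addr _ _).
rewrite -[X in (X <= _)%N](size_iota 1 (a - 2)) -count_predT.
rewrite leq_eqVlt; apply/orP; left; apply/eqP; apply: eq_in_count => j.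
rewrite mem_iota => /andP[j0 j2]; apply/esym/asboolP.
apply: ex_strongly_inessential => //.
by move: j2; rewrite add1n ltnS -(leq_add2r 2) subnK // ltnW.
Qed.

End ExampleEssential.

(** * The height of the example *)

Section CodimensionTwoPrime.

Variable (K : fieldType) (n : nat).
Local Notation S := {mpoly K[n]}.
Implicit Types (f g : S).

Lemma zero_var_comm i j f : zero_var i (zero_var j f) = zero_var j (zero_var i f).
Proof.
move: f; apply: (mpoly_morph_eq (phi := zero_var i \o zero_var j)
  (psi := zero_var j \o zero_var i)) => [c|k] /=; first by rewrite !zero_varC.
rewrite !zero_varX; case: ifP => kj; case: ifP => ki;
  by rewrite ?zero_var0 ?zero_varX ?kj ?ki ?eqxx.
Qed.

Lemma factor_out_var i g : g != 0 ->
  exists k h, g = 'X_i ^+ k * h /\ zero_var i h != 0.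
Proof.
have [m] := ubnP (msize g); elim: m g => // m IH g; rewrite ltnS => le nzg.
have [|nz] := eqVneq (zero_var i g) 0; last by exists 0%N, g; rewrite mul1r.
case/zero_var_eq0 => h Eg; have nzh : h != 0.
  by apply: contraNneq nzg => h0; rewrite Eg h0 mul0r.
have [|k [h' [Eh nz]]] := IH h _ nzh.
  by move: le; rewrite Eg msizeM ?mpolyX_neq0 // msizeX mdeg1 addn2.
by exists k.+1, h'; rewrite exprS -mulrA -Eh mulrC.
Qed.

(** Write [g = X_i ^ k * h] with [h] nonzero modulo [X_i].  Being free of [X_j]
    too, [h] stays outside [(X_i, X_j)]. *)
Lemma prime_contains_var i j (Q : set S) g : is_prime Q ->
  (forall f, Q f -> zero_var j (zero_var i f) = 0) ->
  Q g -> g != 0 -> zero_var j g = g -> Q 'X_i.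
Proof.
move=> prQ QP Qg nzg gj; have [_ _ PQ] := prQ.
have [k [h [Eg nzh]]] := factor_out_var i nzg.
move: (Qg); rewrite Eg => /PQ[/(prime_exp prQ)//|Qh].
have hh : zero_var j h = h \/ j = i.
  have [->|nji] := eqVneq j i; [by right | left].
  apply: (mulfI (expf_neq0 k (mpolyX_neq0 K i))); rewrite -Eg -[RHS]gj Eg.
  by rewrite zero_varM rmorphXn /= zero_varX eq_sym (negbTE nji).
have := QP h Qh; case: hh => [hh|->]; last first.
  by rewrite zero_varK => /eqP; rewrite (negbTE nzh).
by rewrite zero_var_comm hh => /eqP; rewrite (negbTE nzh).
Qed.

End CodimensionTwoPrime.

(** Either [prime_contraction] gives a constant in [Q2] outside [Q1], or [Q1] is
    extended from its constants and already contains a nonzero one. *)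
Lemma prime_eliminate (K : fieldType) n (Q1 Q2 : set {mpoly K[n.+1]}) :
  is_prime Q1 -> is_prime Q2 -> Q1 `<` Q2 -> (exists2 g, Q1 g & g != 0) ->
  exists2 c : {mpoly K[n]}, c != 0 & Q2 (mwiden c).
Proof.
move=> prQ1 prQ2 [Q12 nQ21] [g Q1g nzg].
pose P1 : set {poly {mpoly K[n]}} := [set q | Q1 (mpoly_of_poly q)].
pose P2 : set {poly {mpoly K[n]}} := [set q | Q2 (mpoly_of_poly q)].
have prP1 : is_prime P1 by exact:
  (@is_prime_preim {poly {mpoly K[n]}} {mpoly K[n.+1]} (@mpoly_of_poly K n) Q1 prQ1).
have prP2 : is_prime P2 by exact:
  (@is_prime_preim {poly {mpoly K[n]}} {mpoly K[n.+1]} (@mpoly_of_poly K n) Q2 prQ2).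
have P10 : P1 0 by case: prP1 => -[].
suff [c nzc P2c] : exists2 c : {mpoly K[n]}, c != 0 & P2 c%:P.
  by exists c => //; move: P2c; rewrite /P2 /= mpoly_of_polyC.
have P12 : P1 `<=` P2 by move=> q; apply: Q12.
have [ext|H] := pselect (exists h, P1 h /\ exists i, ~ P1 (h`_i)%:P); last first.
  have nzm : muni g != 0.
    by apply: contraNneq nzg => m0; rewrite -(muniK g) m0 rmorph0.
  exists (lead_coef (muni g)); first by rewrite lead_coef_eq0.
  apply: P12; apply: contrapT => nP; apply: H; exists (muni g).
  by split; [rewrite /P1 /= muniK | exists (size (muni g)).-1].
have [f [P2f nP1f]] : exists f, P2 f /\ ~ P1 f.
  apply: contrapT => H; apply: nQ21 => f Q2f; apply: contrapT => nQ1f.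
  by apply: H; exists (muni f); rewrite /P1 /P2 /= muniK.
have [idP2 _ _] := prP2.
have [c [P2c nP1c]] := @prime_contraction {mpoly K[n]} P1 P2 prP1 idP2 P12 ext
  (ex_intro _ f (conj P2f nP1f)).
exists c; last exact: P2c.
by apply/eqP => c0; apply: nP1c; rewrite c0 polyC0; exact: P10.
Qed.

Section ExampleHeight.

Variable (K : fieldType).
Local Notation S := (poly3 K).
Local Notation X := ('X_var_x : S).
Local Notation Y := ('X_var_y : S).

(** The ideal [(X, Y)], that of the point [(0 : 0 : 1)]. *)
Definition line_prime : set S := [set f | zero_var var_y (zero_var var_x f) = 0].

Lemma is_prime_zero (R : idomainType) : is_prime [set 0 : R].
Proof.
split=> [|/eqP|u v /= /eqP]; last by rewrite mulf_eq0 => /orP[] /eqP; [left | right].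
  split=> //= [u v -> ->|b u ->]; first by rewrite addr0.
  by rewrite mulr0.
by rewrite oner_eq0.
Qed.

Lemma is_prime_var n (i : 'I_n) :
  is_prime [set f : {mpoly K[n]} | zero_var i f = 0].
Proof.
exact: (@is_prime_preim {mpoly K[n]} {mpoly K[n]} (zero_var i) _ (is_prime_zero _)).
Qed.

Lemma is_prime_line : is_prime line_prime.
Proof.
exact: (@is_prime_preim {mpoly K[3]} {mpoly K[3]} (zero_var var_x) _ (is_prime_var var_y)).
Qed.

Lemma zero_y_mwiden (c : {mpoly K[2]}) :
  zero_var (var_y : 'I_3) (mwiden c) = mwiden c.
Proof.
move: c; apply: (mpoly_morph_eq (phi := zero_var (var_y : 'I_3) \o @mwiden 2 K)
  (psi := @mwiden 2 K)) => [c|i] /=; first by rewrite mwidenC zero_varC.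
by rewrite mwiden_X zero_varX -val_eqE /= ltn_eqF.
Qed.

(** A nonzero prime and a larger one inside [(X, Y)]: the larger contains a
    polynomial free of [Y], hence [X], and then [Y] by working modulo [X]. *)
Lemma line_prime_chain : ~ has_prime_chain line_prime 3.
Proof.
case=> Q [prQ ltQ Q3]; have lt01 := ltQ 0%N isT; have lt12 := ltQ 1%N isT.
have [Q23 nQ32] := ltQ 2%N isT; rewrite Q3 in Q23 nQ32.
have [pr1 pr2] := (prQ 1%N isT, prQ 2%N isT).
have [idQ2 _ _] := pr2; have [Q12 nQ21] := lt12.
have [g Q1g nzg] : exists2 g, Q 1%N g & g != 0.
  apply: contrapT => H; case: lt01 => _; apply=> g Q1g.
  suff -> : g = 0 by case: (prQ 0%N isT) => -[].
  by apply/eqP/negPn/negP => nz; apply: H; exists g.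
have [c nzc Q2c] := @prime_eliminate K 2 _ _ pr1 pr2 lt12 (ex_intro2 _ _ g Q1g nzg).
have Q2X : Q 2%N X.
  apply: (@prime_contains_var K 3 var_x var_y _ (mwiden c)) => //.
  - apply: contraNneq nzc => c0; apply/eqP.
    by apply: (@inj_mwiden 2 K); rewrite c0 mwiden0.
  - exact: zero_y_mwiden.
have zx f : Q 2%N f -> Q 2%N (zero_var var_x f).
  move=> Qf; have [q Eq] := zero_var_divides var_x f.
  rewrite -(subKr f (zero_var var_x f)) Eq.
  by apply: (idealB idQ2) => //; apply: (idealMl _ idQ2).
have Q2Y : Q 2%N Y.
  have [h Q2h nzh] : exists2 h, Q 2%N h & zero_var var_x h != 0.
    have [Q1X|nQ1X] := pselect (Q 1%N X).
      have [h [Q2h nQ1h]] : exists h, Q 2%N h /\ ~ Q 1%N h.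
        apply: contrapT => H; apply: nQ21 => h Q2h; apply: contrapT => nQ1h.
        by apply: H; exists h.
      exists h => //; apply/eqP => /zero_var_eq0[q Eq]; apply: nQ1h.
      by rewrite Eq; have [idQ1 _ _] := pr1; apply: (idealMl _ idQ1).
    have [k [h [Eg nzh]]] := factor_out_var var_x nzg; exists h => //.
    apply: Q12; have [_ _ PQ1] := pr1; move: Q1g; rewrite Eg => /PQ1[|//].
    by move/(prime_exp pr1).
  apply: (@prime_contains_var K 3 var_y var_x _ (zero_var var_x h)) => //.
  - by move=> f Q2f; rewrite zero_var_comm; apply: Q23.
  - exact: zx.
  - exact: zero_varK.
apply: nQ32 => f /zero_var2_divides[p [q ->]].
by apply: (idealD idQ2); apply: (idealMl _ idQ2).
Qed.

Lemma ex_sub_line a : (0 < a)%N -> @ex_ideal K a `<=` line_prime.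
Proof.
move=> a0; apply: ideal_gen_min; first by case: is_prime_line.
move=> _ /mem_ex_basis[j ja ->]; rewrite /line_prime /= /ex_form /minor.
rewrite !zero_varM; case: j ja => [|j] ja.
  by rewrite subn0 -(prednK a0) exprS !zero_varM zero_varX eqxx zero_var0 !mul0r.
rewrite zero_x_tail_minor mulnS exprD zero_varM expr2 zero_varM zero_varX eqxx.
by rewrite !mul0r mulr0.
Qed.

(** A prime over the ideal contains [X], by [ex_form a 0], and [Y], because
    [ex_form a a] is a power of [Y] modulo [X]. *)
Lemma ex_height a : (0 < a)%N -> has_height (@ex_ideal K a) 2.
Proof.
move=> a0; split=> [P prP IP|].
  have [idP _ PP] := prP.
  have PX : P X.
    apply: (prime_exp (k := a) prP); apply: IP.
    have := @ex_form_in K a 0 (leq0n a).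
    by rewrite /ex_form /minor subn0 tail_minor0 mulr1; apply.
  have PY : P Y.
    apply: (prime_exp (k := 2 * a) prP).
    have [c Ec] := tail_minor_modX X Y ('X_var_z : S) a.
    have -> : Y ^+ (2 * a) = ex_form K a a - X * c.
      by rewrite /ex_form /minor subnn mul1r Ec addrK.
    apply: (idealB idP); last exact: (idealMr _ idP).
    by apply: IP; apply: ex_form_in.
  exists (fun i => if i is 0 then [set 0] else
          if i is 1 then [set f | zero_var var_x f = 0] else P); split=> //.
  - case=> [|[|[|//]]] _; [exact: is_prime_zero | exact: is_prime_var | exact: prP].
  - case=> [|[|//]] _; split.
    + by move=> _ ->; rewrite /= zero_var0.
    + move=> /(_ X); rewrite /= zero_varX eqxx => /(_ erefl)/eqP.
      by rewrite (negbTE (mpolyX_neq0 K var_x)).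
    + by move=> f /zero_var_eq0[q ->]; apply: (idealMl _ idP).
    + move=> /(_ Y PY) /=; rewrite zero_varX /= => /eqP.
      by rewrite (negbTE (mpolyX_neq0 K var_y)).
exists line_prime; split; [exact: is_prime_line | exact: ex_sub_line |].
exact: line_prime_chain.
Qed.

End ExampleHeight.

(** * The projective dimension of the example *)

Section IdealModules.

Variables (R : comNzRingType) (I : set R) (idI : is_ideal I).

(** The proof argument lets closure instances be attached to the predicate. *)
Definition ideal_pred of is_ideal I : {pred R^o} := fun x => `[< I x >].

Fact ideal_pred_submod : submod_closed (ideal_pred idI).
Proof.
split=> [|c x y /asboolP Ix /asboolP Iy]; apply/asboolP; first by case: idI.
by apply: idealD => //; apply: idealMl.
Qed.

HB.instance Definition _ :=
  GRing.isSubmodClosed.Build R R^o (ideal_pred idI) ideal_pred_submod.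

Definition ideal_sub := {x : R^o | ideal_pred idI x}.

HB.instance Definition _ := SubChoice.on ideal_sub.
HB.instance Definition _ := [SubChoice_isSubLmodule of ideal_sub by <:].

Definition ideal_quot := Quotient.quot (ideal_pred idI).

HB.instance Definition _ := GRing.Zmodule.on ideal_quot.

Definition quot_proj (x : R^o) : ideal_quot := \pi_(ideal_quot)%qT x.

Lemma quot_proj_eq (x y : R^o) : quot_proj x = quot_proj y <-> I (x - y).
Proof.
split=> [/eqP|H].
  by rewrite /quot_proj -Quotient.idealrBE => /asboolP.
by apply/eqP; rewrite /quot_proj -Quotient.idealrBE; apply/asboolP.
Qed.

Lemma quot_projK (x : ideal_quot) : quot_proj (repr x) = x.
Proof. exact: reprK. Qed.

Lemma quot_projD : {morph quot_proj : x y / x + y}.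
Proof. exact: raddfD. Qed.

Definition quot_scale (b : R) (x : ideal_quot) : ideal_quot :=
  quot_proj (b *: repr x).

Lemma quot_scaleE b x : quot_scale b (quot_proj x) = quot_proj (b *: x).
Proof.
apply/quot_proj_eq; rewrite -scalerBr; apply: idealMl => //; apply/quot_proj_eq.
by rewrite quot_projK.
Qed.

Fact quot_scaleA b c x : quot_scale b (quot_scale c x) = quot_scale (b * c) x.
Proof. by rewrite -[x]quot_projK !quot_scaleE scalerA. Qed.

Fact quot_scale1 : left_id 1 quot_scale.
Proof. by move=> x; rewrite -[x]quot_projK quot_scaleE scale1r. Qed.

Fact quot_scaleDr : right_distributive quot_scale +%R.
Proof.
move=> b x y; rewrite -[x]quot_projK -[y]quot_projK -quot_projD !quot_scaleE.
by rewrite -quot_projD scalerDr.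
Qed.

Fact quot_scaleDl x : {morph quot_scale^~ x : b c / b + c}.
Proof.
by move=> b c; rewrite -[x]quot_projK !quot_scaleE -quot_projD scalerDl.
Qed.

HB.instance Definition _ := GRing.Zmodule_isLmodule.Build R ideal_quot
  quot_scaleA quot_scale1 quot_scaleDr quot_scaleDl.

Fact quot_proj_linear : linear quot_proj.
Proof. by move=> b x y; rewrite quot_projD -quot_scaleE. Qed.

HB.instance Definition _ :=
  GRing.isLinear.Build R R^o ideal_quot _ quot_proj quot_proj_linear.

Lemma ideal_quot_is_quotient : is_quotient I ideal_quot.
Proof.
exists quot_proj; split=> [y|x]; first by exists (repr y); apply: quot_projK.
rewrite -[0](linear0 quot_proj) /=; split=> [/quot_proj_eq|Ix].
  by rewrite subr0.
by apply/quot_proj_eq; rewrite subr0.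
Qed.

End IdealModules.

Section MakeLinear.

Variables (R : nzRingType) (U V : lmodType R).

Definition linear_fun (f : U -> V) (lin_f : linear f) := f.

HB.instance Definition _ f lin_f :=
  GRing.isLinear.Build R U V _ (@linear_fun f lin_f) lin_f.

End MakeLinear.

Lemma projective_rV (R : comNzRingType) n : @projective R 'rV[R]_n.
Proof.
move=> M N g h surj_g.
have [y Ey] := choice (fun i => surj_g (h (delta_mx 0 i))).
have lin : linear (fun v : 'rV[R]_n => \sum_i v 0 i *: y i).
  move=> b u v; rewrite scaler_sumr -big_split; apply: eq_bigr => i _.
  by rewrite !mxE scalerDl scalerA.
exists (linear_fun lin) => v; rewrite /linear_fun /= linear_sum {2}(row_sum_delta v).
rewrite linear_sum; apply: eq_bigr => i _.
by rewrite !linearZ Ey.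
Qed.

(** Schanuel: if [R / I] has a resolution of length one, then [I] is projective
    and the presentation by the generators [f i] splits; the [k i] are the
    components of the splitting.  The splitting is built from a lift [p] of [1],
    by lifting to the generators the map from [P 1] to [I]. *)
Lemma short_resolution_splits (R : comNzRingType) (I : set R) N (f : 'I_N -> R)
    (M : lmodType R) m :
  is_ideal I -> (forall x, I x <-> exists u : 'I_N -> R, x = \sum_i u i * f i) ->
  is_quotient I M -> projdim_le M m -> (m <= 1)%N ->
  exists k : 'I_N -> R -> R, (forall x, I x -> x = \sum_i k i x * f i) /\
    forall x y i, I x -> I y -> x * k i y = y * k i x.
Proof.
move=> idI IP [pi [surj_pi piI]] [P [d [e [projP P0 surj_e exact0 exact]]]] m1.
have [phi Ephi] := projP 0%N R^o M pi e surj_pi.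
have [p Ep] := surj_e (pi 1).
have d0_inj x : d 0%N x = 0 -> x = 0.
  case/exact => y <-; rewrite (P0 2%N _ y) ?linear0 //.
have I_phi x : I (phi (d 0%N x)).
  by apply/piI; rewrite Ephi; apply/exact0; exists x.
pose J : lmodType R := ideal_sub idI.
have pJ x : I x -> ideal_pred idI x by move=> Ix; apply/asboolP.
pose rho0 x : J := Sub (phi (d 0%N x)) (pJ _ (I_phi x)).
have lin_rho0 : linear rho0.
  by move=> b x y; apply: val_inj; rewrite /= !linearP.
have I_sum (u : 'I_N -> R) : I (\sum_i u i * f i) by apply/IP; exists u.
pose g (u : 'rV[R]_N) : J := Sub (\sum_i u 0 i * f i) (pJ _ (I_sum (u 0))).
have lin_g : linear g.
  move=> b u v; apply: val_inj; rewrite /= scaler_sumr -big_split.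
  by apply: eq_bigr => i _; rewrite !mxE mulrDl -mulrA.
have surj_g y : exists u, linear_fun lin_g u = y.
  have /IP[u Eu] : I (val y) by apply/asboolP/(valP y).
  exists (\row_i u i); apply: val_inj; rewrite /= Eu.
  by apply: eq_bigr => i _; rewrite mxE.
have [rho Erho] := projP 1%N _ _ (linear_fun lin_g) (linear_fun lin_rho0) surj_g.
have rhoE x : \sum_i rho x 0 i * f i = phi (d 0%N x).
  by have := congr1 val (Erho x).
(* Multiplication by [p] maps [I] into the kernel of [e], that is into [P 1]. *)
have theta_ex x : exists y, I x -> d 0%N y = x *: p.
  have [Ix|nIx] := pselect (I x); last by exists 0.
  have /exact0[y Ey] : e (x *: p) = 0; last by exists y.
  rewrite linearZ /= Ep -linearZ; apply/piI.
  by rewrite -[_ *: _]/(x * 1) mulr1.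
have [theta Etheta] := choice theta_ex.
have [b Eb] : exists b : 'I_N -> R, phi p - 1 = \sum_i b i * f i.
  by apply/IP/piI; rewrite linearB Ephi Ep subrr.
exists (fun i x => rho (theta x) 0 i - x * b i); split=> [x Ix|x y i Ix Iy].
  under eq_bigr do rewrite mulrBl -mulrA.
  rewrite sumrB rhoE Etheta // -mulr_sumr -Eb mulrBr mulr1.
  have -> : phi (x *: p) = x * phi p by rewrite linearZ.
  by rewrite opprB addrC subrK.
have E : x *: theta y = y *: theta x.
  apply/eqP; rewrite -subr_eq0; apply/eqP/d0_inj.
  rewrite linearB !linearZ /= !Etheta // !scalerA scalerN scalerA.
  by rewrite mulrC subrr.
rewrite !mulrBr [y * (x * _)]mulrCA; congr (_ - _).
by have := congr1 (fun z => rho z 0 i) E; rewrite !linearZ !mxE.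
Qed.

Section ExampleResolution.

Variable (K : fieldType).
Local Notation S := (poly3 K).
Local Notation X := ('X_var_x : S).
Local Notation Y := ('X_var_y : S).
Local Notation Z := ('X_var_z : S).

Lemma tail_minor_divXn a k (u w : S) :
  u * tail_minor X Y Z a = X ^+ k * w -> divides (X ^+ k) u.
Proof.
elim: k u w => [|k IH] u w E; first by exists u; rewrite mulr1.
have [|v Ev] := @tail_minor_divX _ X Y Z (@var_regXY K) a u (X ^+ k * w).
  by rewrite E exprS mulrA.
have [|c Ec] := IH v w; last by exists c; rewrite Ev Ec exprSr mulrA.
apply: (mulfI (mpolyX_neq0 K var_x)).
by rewrite mulrA [X * v]mulrC -Ev E exprS mulrA.
Qed.

(** Otherwise the components of a splitting would satisfy
    [X ^ a * k i (ex_form a a) = ex_form a a * k i (X ^ a)].  As [ex_form a a] is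
    a nonzerodivisor modulo [X], each [k i (X ^ a)] would be a multiple of
    [X ^ a], and [1] would lie in the ideal. *)
Lemma ex_no_short_resolution a (M : lmodType S) m : (0 < a)%N ->
  is_quotient (@ex_ideal K a) M -> projdim_le M m -> (1 < m)%N.
Proof.
move=> a0 quotM resM; rewrite ltnNge; apply/negP => m1.
have idI := @is_ideal_ex K a.
have [|k [Ek prop]] := @short_resolution_splits S _ a.+1
  (fun j => ex_form K a j) M m idI _ quotM resM m1.
  move=> x; rewrite ex_idealP; split=> -[u ->].
    by exists (fun j => u j).
  exists (fun j => u (inord j)); apply: eq_bigr => j _; by rewrite inord_val.
have Ef0 : ex_form K a 0 = X ^+ a by rewrite /ex_form /minor subn0 mulr1.
have I0 : ex_ideal a (ex_form K a 0) by apply: ex_form_in.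
have Ia : ex_ideal a (ex_form K a a) by apply: ex_form_in.
have /choice[c Ec] : forall i, divides (X ^+ a) (k i (ex_form K a 0)).
  move=> i; apply: (@tail_minor_divXn a a _ (k i (ex_form K a a))).
  by rewrite -Ef0 (prop _ _ _ I0 Ia) /ex_form [in RHS]/minor subnn expr0 mul1r mulrC.
have E1 : \sum_(i < a.+1) c i * ex_form K a i = 1.
  apply: (mulfI (expf_neq0 a (mpolyX_neq0 K var_x))); rewrite mulr1 -[RHS]Ef0.
  rewrite [RHS](Ek _ I0) mulr_sumr; apply: eq_bigr => i _.
  by rewrite Ec mulrA [X ^+ a * _]mulrC.
have : ex_ideal a (\sum_(i < a.+1) c i * ex_form K a i).
  apply: (@ideal_sum S _ _ _ _ _ idI) => i _; apply: (idealMl _ idI).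
  by apply: ex_form_in; rewrite -ltnS.
by rewrite E1 => /(ex_sub_line a0); have [_ + _] := is_prime_line K; apply.
Qed.

Section Resolution.

Variable a : nat.

Definition ex_rank i := match i with 0 => 1 | 1 => a.+1 | 2 => a | _ => 0 end%N.

Definition ex_d0 (v : 'rV[S]_a.+1) : 'rV[S]_1 :=
  const_mx (\sum_(j < a.+1) v 0 j * ex_form K a j).

(** The coefficient of the syzygy [sigma_j], for [j] starting from [1], is the
    entry of index [j - 1]. *)
Definition syz_index (w : 'rV[S]_a) j :=
  if j is k.+1 then oapp (w 0) 0 (insub k) else 0.

Definition ex_d1 (w : 'rV[S]_a) : 'rV[S]_a.+1 :=
  \row_j syz_comb X Y Z (syz_index w) j.

Fact ex_d0_linear : linear ex_d0.
Proof.
move=> b u v; apply/rowP => i; rewrite !mxE mulr_sumr -big_split.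
by apply: eq_bigr => j _; rewrite !mxE mulrDl mulrA.
Qed.

Fact ex_d1_linear : linear ex_d1.
Proof.
move=> b u v; apply/rowP => j; rewrite !mxE -syz_comb_linear.
have E i : syz_index (b *: u + v) i = b * syz_index u i + syz_index v i.
  case: i => [|i] /=; first by rewrite mulr0 addr0.
  by case: insubP => [k _ _|_] /=; rewrite ?mxE // mulr0 addr0.
by rewrite /syz_comb !E.
Qed.

Lemma syz_index_coef w : syz_coef a (syz_index w).
Proof. by split=> // -[//|j] /= ja; rewrite insubF // ltnNge -ltnS ja. Qed.

Definition ex_diff i : 'rV[S]_(ex_rank i.+1) -> 'rV[S]_(ex_rank i) :=
  match i with 0 => ex_d0 | 1 => ex_d1 | _ => fun=> 0 end.

Fact ex_diff_linear i : linear (@ex_diff i).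
Proof.
case: i => [|[|i]]; [exact: ex_d0_linear | exact: ex_d1_linear |].
by move=> b u v /=; rewrite scaler0 addr0.
Qed.

(** Exactness in the middle is [minor_syzygies], on the left [syz_comb_inj]. *)
Lemma ex_resolution (M : lmodType S) :
  is_quotient (@ex_ideal K a) M -> projdim_le M 2.
Proof.
case=> pi [surj_pi piI].
have lin_e : linear (fun v : 'rV[S]_1 => pi (v 0 0)).
  by move=> b u v; rewrite !mxE -linearP.
exists (fun i => 'rV[S]_(ex_rank i)), (fun i => linear_fun (@ex_diff_linear i)).
exists (linear_fun lin_e); split=> [i|i i2 x|y|x|i x].
- exact: projective_rV.
- by case: i i2 x => [|[|[|i]]] // _ x; apply/rowP => -[].
- by have [x Ex] := surj_pi y; exists (const_mx x); rewrite /= /linear_fun mxE.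
- rewrite /= /linear_fun piI ex_idealP; split=> [[u Eu]|[v <-]].
    exists (\row_j u j); apply/rowP => i; rewrite ord1 mxE Eu.
    by apply: eq_bigr => j _; rewrite mxE.
  exists (fun j => v 0 (inord j)); rewrite mxE; apply: eq_bigr => j _.
  by rewrite inord_val.
case: i x => [|[|i]] x; rewrite /= /linear_fun /=; last first.
- by split=> // _; exists 0; apply/rowP => -[].
- split=> [d0|[y <-]]; last first.
    apply/rowP => j; rewrite !mxE /syz_comb.
    have E i : syz_index 0 i = 0.
      by case: i => [|i] //=; case: insubP => [k _ _|_] //=; rewrite mxE.
    by rewrite !E !mulr0 !subr0.
  exists 0; apply/esym/rowP => k; rewrite mxE.
  have H j : (j <= a)%N -> syz_comb X Y Z (syz_index x) j = 0.
    move=> ja; have /rowP/(_ (Ordinal (ja : j < a.+1)%N)) := d0.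
    by rewrite !mxE.
  have := syz_comb_inj (mpolyX_neq0 K var_x) (syz_index_coef x) H k.+1.
  by rewrite /= valK.
- split=> [d0|[y <-]]; last first.
    apply/rowP => i; rewrite !mxE -[RHS](syz_combE X Y Z (syz_index_coef y)).
    by apply: eq_bigr => j _; rewrite mxE.
  have [|w [wc Ew]] := minor_syzygies (mpolyX_neq0 K var_x) (@var_regXY K)
    (a := a) (u := fun j => x 0 (inord j)) (Y := Y) (Z := Z).
    have /rowP/(_ 0) := d0; rewrite !mxE => E; rewrite -[RHS]E.
    by apply: eq_bigr => j _; rewrite inord_val.
  have [w0 wa] := wc.
  have E j : syz_index (\row_k w k.+1) j = w j.
    case: j => [|j] /=; first by rewrite w0.
    case: insubP => [k _ <-|] /=; first by rewrite mxE.
    by rewrite -leqNgt => ja; rewrite wa.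
  exists (\row_k w k.+1); apply/rowP => j; rewrite mxE.
  by rewrite /syz_comb !E -/(syz_comb X Y Z w j) -Ew -1?ltnS // inord_val.
Qed.

Lemma ex_perfect : (0 < a)%N -> perfect_height2 (@ex_ideal K a).
Proof.
move=> a0; split; first exact: ex_height.
have idI := @is_ideal_ex K a; exists (ideal_quot idI).
have quotM := ideal_quot_is_quotient idI; split=> //; split.
  exact: ex_resolution.
by move=> m; apply: (ex_no_short_resolution a0 quotM).
Qed.

End Resolution.

End ExampleResolution.

(** * The largest number of strongly inessential members *)

Theorem corollary5p1 (K : closedFieldType) :
  (forall (I : set {mpoly K[3]}) (a : nat) (B : seq {mpoly K[3]}),
      in_F3 I -> is_alpha I a -> e_maximal I B ->
      (num_strongly_inessential I B <= a - 2)%N) /\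
  (forall a : nat, (1 <= a)%N ->
     exists (I : set {mpoly K[3]}) (B : seq {mpoly K[3]}),
       [/\ in_F3 I, is_alpha I a, e_maximal I B
         & num_strongly_inessential I B = (a - 2)%N]).
Proof.
split=> [I a B [_ _ [a' [alphaI [B' [stB' sizeB']]]]] alphaI' [stB _]|a a0].
  have := strongly_inessential_bound stB.
  by rewrite (standard_basis_size stB stB') sizeB' (is_alpha_unique alphaI alphaI').
have stB := ex_standard K a; exists (@ex_ideal K a), (ex_basis K a); split.
- split; [exact: ex_homogeneous | exact: ex_perfect | exists a].
  split; first exact: ex_alpha.
  by exists (ex_basis K a); rewrite size_ex_basis.
- exact: ex_alpha.
- exact: ex_e_maximal.
apply/eqP; rewrite eqn_leq ex_num_strongly_inessential andbT.
by have := strongly_inessential_bound stB; rewrite size_ex_basis.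
Qed.
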